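(* For each irrational $\theta\in(0,1)$, the function $\tau\mapsto\dim_H\mathcal U_\tau[\theta]$ is continuous on $(0,1)\cup(1,\infty)$.
   Context: $\mathbb T=\mathbb R/\mathbb Z$; points identified with fractional parts. $\|t\|$ is the distance from $t$ to the nearest integer. For $\tau>0$, $\mathcal U_\tau[\theta]$ is the set of $y\in\mathbb T$ such that there exists $Q_0$ with: for every real $Q\ge Q_0$ there is an integer $1\le n\le Q$ with $\|n\theta-y\|<Q^{-\tau}$. *)

(* Defs.v *)
From Stdlib Require Import Reals Lra Lia ZArith.
Open Scope R_scope.

Definition dist_int (x : R) : R := Rmin (frac_part x) (1 - frac_part x).

(* Points of T = R/Z are represented by their fractional part y in [0,1). *)
Definition in_torus (y : R) : Prop := 0 <= y < 1.

Definition U_set (tau theta : R) (y : R) : Prop :=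
  in_torus y /\
  exists Q0 : R, forall Q : R, Q >= Q0 ->
    exists n : nat, (1 <= n)%nat /\ INR n <= Q /\
      dist_int (INR n * theta - y) < Rpower Q (- tau).

Definition hausdorff_null (s : R) (E : R -> Prop) : Prop :=
  forall delta eps : R, 0 < delta -> 0 < eps ->
    exists a b : nat -> R,
      (forall k, a k < b k /\ b k - a k <= delta) /\
      (forall x, E x -> exists k, a k <= x <= b k) /\
      (forall N, sum_f_R0 (fun k => Rpower (b k - a k) s) N <= eps).

Definition is_hausdorff_dim (E : R -> Prop) (d : R) : Prop :=
  (forall s, 0 <= s -> hausdorff_null s E -> d <= s) /\
  (forall d', (forall s, 0 <= s -> hausdorff_null s E -> d' <= s) -> d' <= d).

Definition irrational (x : R) : Prop :=
  forall p q : Z, q <> 0%Z -> x <> IZR p / IZR q.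

(* Main.v *)
Require Import Defs.
From Stdlib Require Import Reals ZArith.
From Stdlib Require Import Lra Lia List Classical ClassicalEpsilon Cantor.
Open Scope R_scope.

(* Let q_k be the denominators of the convergents of theta, a_k = ln q_k, b_k = a_k + a_{k+1} and
   c = tau / (1 + tau).  At the critical scale Q = exp ((1 - c) b_k), a point of U_tau lies within
   about Q^(-tau) = exp (- c b_k) of some n theta with n <= q_k, while the points n theta, n <= q_k,
   are about 1 / q_k apart.  So U_tau is essentially a homogeneous Cantor set, with exp V_k(c)
   intervals of length exp (- mu_k(c)) at level k, where
     V_k(c) = a_k - sum_{j<k} max 0 (c b_j - a_j),   mu_k(c) = max a_k (c b_k)             if tau < 1,
     V_k(c) = sum_{j<k} max 0 (a_{j+1} - c b_j),     mu_k(c) = max (tau a_k) (c b_k)       if tau > 1,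
   and its dimension is liminf V_k / mu_k.  Bounded factors at each level are absorbed by changing c
   slightly, which is harmless because V_k / mu_k is uniformly continuous in c away from c = 1/2:
   a nonzero term of V_k forces |1 - 2c| b_j <= a_{j+1} - a_j, so the variation of the sum telescopes. *)

(** * Convergents *)

(** The exponent comes from a balance. Writing n = v + u q_k with v <= q_k moves the point n theta
    by about u / q_{k+1}, hence by at most Q / (q_k q_{k+1}); this equals Q^(-tau) when Q = exp ((1
    - c) b_k), and there Q^(-tau) = exp (- c b_k). The two regimes differ in which comparison can
    fail. For c < 1/2 a cluster of radius exp (- c b_k) always spans the next spacing 1 / q_{k+1},
    but neighbouring clusters merge when c b_k <= a_k and the level then imposes nothing: V_k
    records a loss of length. For c > 1/2 the clusters are essentially disjoint, but may hold a
    single point of the next level: V_k counts points. The obstacle is that q_{k+1} / q_k is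
    unbounded, so intervals of intermediate length must be controlled as well; the tree lemma
    therefore also takes a width W_k over which the children of a node spread. The liminf is never
    formed: nullity follows from V_k <= s mu_k for infinitely many k, non-nullity from s mu_k <= V_k
    for all large k, at two nearby values of c. *)

Record convergents (theta : R) := {
  den : nat -> Z;
  numer : nat -> Z;
  err : nat -> R;
  sgn : nat -> R;
  sgn_pm1 : forall k, sgn k = 1 \/ sgn k = -1;
  sgn_S : forall k, sgn (S k) = - sgn k;
  err_eq : forall k, IZR (den k) * theta - IZR (numer k) = sgn k * err k;
  err_pos : forall k, 0 < err k;
  err_decr : forall k, err (S k) < err k;
  den_0 : den 0%nat = 1%Z;
  den_le : forall k, (den k <= den (S k))%Z;
  den_grow : forall k, (den k + den (S k) <= den (S (S k)))%Z;
  den_err : forall k, IZR (den (S k)) * err k + IZR (den k) * err (S k) = 1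
}.
Arguments den {theta}. Arguments numer {theta}. Arguments err {theta}. Arguments sgn {theta}.
Arguments sgn_pm1 {theta}. Arguments sgn_S {theta}. Arguments err_eq {theta}.
Arguments err_pos {theta}. Arguments err_decr {theta}.
Arguments den_0 {theta}. Arguments den_le {theta}. Arguments den_grow {theta}. Arguments den_err {theta}.

(* A state (((q, p), D), ((q', p'), D')) holds two consecutive convergents. *)
Definition cf_step (x : (Z * Z * R) * (Z * Z * R)) : (Z * Z * R) * (Z * Z * R) :=
  let '((q, p, d), (q', p', d')) := x in
  let a := Int_part (d / d') in
  ((q', p', d'), ((q + a * q')%Z, (p + a * p')%Z, d - IZR a * d')).

(** The initial pair carries the indices -1 and 0, with errors 1 and theta; [den cf k] will be read
    off the second component. *)
Definition cf_state (theta : R) (k : nat) :=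
  Nat.iter k cf_step ((0%Z, 1%Z, 1), (1%Z, 0%Z, theta)).

Lemma convergents_exist (theta : R) :
  irrational theta -> 0 < theta -> theta < 1 -> inhabited (convergents theta).
Proof.
  intros Hirr H0 H1.
  set (sg := fun k : nat => (-1) ^ k).
  assert (Hsg : forall k, sg k = 1 \/ sg k = -1).
  { induction k as [|k IH]; unfold sg in *; simpl; [left; reflexivity|].
    destruct IH as [-> | ->]; [right | left]; lra. }
  assert (Inv : forall k, let '((q, p, d), (q', p', d')) := cf_state theta k in
    (0 <= q)%Z /\ (1 <= q')%Z /\ (k = 0%nat \/ q <= q')%Z /\ 0 < d' /\ d' < d /\
    IZR q * theta - IZR p = - sg k * d /\ IZR q' * theta - IZR p' = sg k * d' /\
    IZR q' * d + IZR q * d' = 1).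
  { induction k as [|k IH].
    - simpl. unfold sg; simpl. repeat split; try lia; try lra.
    - unfold cf_state in *. simpl. destruct (Nat.iter k cf_step _) as [[[q p] d] [[q' p'] d']].
      destruct IH as (Hq & Hq' & Hqq & Hd' & Hdd & He & He' & Hdet). simpl.
      destruct (base_Int_part (d / d')) as [Ha1 Ha2].
      set (a := Int_part (d / d')) in *.
      assert (Ha : (1 <= a)%Z).
      { assert (1 < d / d') by (apply Rmult_lt_reg_r with d'; [lra|]; field_simplify; lra).
        assert (0 < a)%Z by (apply lt_IZR; lra). lia. }
      assert (Hlo : IZR a * d' <= d).
      { apply Rmult_le_compat_r with (r := d') in Ha1; [|lra].
        replace (d / d' * d') with d in Ha1 by (field; lra). lra. }
      assert (Hhi : d - IZR a * d' < d').
      { assert (d / d' < IZR a + 1) as Hx by lra.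
        apply Rmult_lt_compat_r with (r := d') in Hx; [|lra].
        replace (d / d' * d') with d in Hx by (field; lra). lra. }
      assert (E1 : IZR (q + a * q') * theta - IZR (p + a * p') = - sg k * (d - IZR a * d')).
      { rewrite !plus_IZR, !mult_IZR.
        replace ((IZR q + IZR a * IZR q') * theta - (IZR p + IZR a * IZR p')) with
          ((IZR q * theta - IZR p) + IZR a * (IZR q' * theta - IZR p')) by ring.
        rewrite He, He'. ring. }
      (* A zero remainder would make theta rational; irrationality enters only here. *)
      assert (Hne : d - IZR a * d' <> 0).
      { intro Hz. rewrite Hz in E1.
        apply (Hirr (p + a * p')%Z (q + a * q')%Z); [nia|].
        assert (IZR (q + a * q') <> 0) by (apply not_0_IZR; nia).
        apply Rmult_eq_reg_l with (IZR (q + a * q')); [|assumption].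
        field_simplify; [lra|assumption]. }
      repeat split.
      + lia.
      + nia.
      + right; nia.
      + lra.
      + lra.
      + rewrite He'. unfold sg; simpl. ring.
      + rewrite E1. unfold sg; simpl. ring.
      + rewrite plus_IZR, mult_IZR. nra. }
  assert (Hfst : forall k, fst (cf_state theta (S k)) = snd (cf_state theta k)).
  { intro k. unfold cf_state; simpl. destruct (Nat.iter k cf_step _) as [[[q p] d] [[q' p'] d']].
    reflexivity. }
  assert (Inv' : forall k, let '((q, p, d), (q', p', d')) := (snd (cf_state theta k), snd (cf_state theta (S k))) in
    (q <= q')%Z /\ 0 < d /\ d' < d /\ IZR q * theta - IZR p = sg k * d /\ IZR q' * d + IZR q * d' = 1).
  { intro k. generalize (Inv (S k)) (Inv k). rewrite <- Hfst.
    destruct (cf_state theta (S k)) as [[[q p] d] [[q' p'] d']] eqn:E. simpl.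
    intros (Hq & Hq' & Hqq & Hd' & Hdd & He & He' & Hdet) _.
    repeat split; auto; try lra.
    - destruct Hqq; [discriminate|lia].
    - rewrite He. unfold sg; simpl; ring. }
  assert (Hgrow : forall k, (fst (fst (snd (cf_state theta k))) + fst (fst (snd (cf_state theta (S k))))
     <= fst (fst (snd (cf_state theta (S (S k))))))%Z).
  { intro k. generalize (Inv (S k)). rewrite <- Hfst.
    change (cf_state theta (S (S k))) with (cf_step (cf_state theta (S k))).
    destruct (cf_state theta (S k)) as [[[q p] d] [[q' p'] d']] eqn:E. simpl.
    intros (Hq & Hq' & Hqq & Hd' & Hdd & He & He' & Hdet).
    destruct (base_Int_part (d / d')) as [Ha1 Ha2].
    assert (1 < d / d') by (apply Rmult_lt_reg_r with d'; [lra|]; field_simplify; lra).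
    assert (0 < Int_part (d / d'))%Z by (apply lt_IZR; lra). nia. }
  constructor.
  refine {| den := fun k => fst (fst (snd (cf_state theta k)));
            numer := fun k => snd (fst (snd (cf_state theta k)));
            err := fun k => snd (snd (cf_state theta k));
            sgn := sg |}; auto; try (intro k; specialize (Inv' k);
   destruct (snd (cf_state theta k)) as [[q p] d]; destruct (snd (cf_state theta (S k))) as [[q' p'] d']; simpl; tauto).
  - intro k. unfold sg; simpl; ring.
Qed.

Section Convergents.
Variables (theta : R) (cf : convergents theta).
Local Notation q := (den cf).
Local Notation p := (numer cf).
Local Notation D := (err cf).
Local Notation sg := (sgn cf).

Lemma den_ge1 k : (1 <= q k)%Z.
Proof. induction k; [rewrite den_0; lia|]. pose proof (den_le cf k). lia. Qed.

Lemma den_mono j k : (j <= k)%nat -> (q j <= q k)%Z.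
Proof. induction 1; [lia|]. pose proof (den_le cf m). lia. Qed.

Lemma den_ge_index k : (Z.of_nat k <= q (S k))%Z.
Proof.
  induction k; [pose proof (den_ge1 1); lia|].
  pose proof (den_grow cf k). pose proof (den_ge1 k). lia.
Qed.

Lemma den_IZR_ge1 k : 1 <= IZR (q k).
Proof. apply IZR_le, den_ge1. Qed.

Lemma abs_sgn k : Rabs (sg k) = 1.
Proof. unfold Rabs. destruct (sgn_pm1 cf k) as [-> | ->]; destruct Rcase_abs; lra. Qed.

Lemma err_le k : D k <= / IZR (q (S k)).
Proof.
  pose proof (den_err cf k). pose proof (den_IZR_ge1 k). pose proof (den_IZR_ge1 (S k)).
  pose proof (err_pos cf k). pose proof (err_pos cf (S k)).
  apply Rmult_le_reg_l with (IZR (q (S k))); [lra|]. rewrite Rinv_r by lra. nra.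
Qed.

Lemma err_ge k : / (2 * IZR (q (S k))) <= D k.
Proof.
  pose proof (den_err cf k). pose proof (den_IZR_ge1 k). pose proof (den_IZR_ge1 (S k)).
  pose proof (err_pos cf k). pose proof (err_pos cf (S k)). pose proof (err_decr cf k).
  pose proof (IZR_le _ _ (den_le cf k)).
  apply Rmult_le_reg_l with (2 * IZR (q (S k))); [lra|]. rewrite Rinv_r by lra. nra.
Qed.

Lemma det_eq k : IZR (p k * q (S k) - p (S k) * q k) = - sg k.
Proof.
  rewrite minus_IZR, !mult_IZR.
  pose proof (err_eq cf k) as E1. pose proof (err_eq cf (S k)) as E2.
  pose proof (den_err cf k) as E3. rewrite sgn_S in E2.
  replace (IZR (p k)) with (IZR (q k) * theta - sg k * D k) by lra.
  replace (IZR (p (S k))) with (IZR (q (S k)) * theta + sg k * D (S k)) by lra.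
  transitivity (- sg k * (IZR (q (S k)) * D k + IZR (q k) * D (S k))); [ring|].
  rewrite E3; ring.
Qed.

Lemma det_pm1 k : (p k * q (S k) - p (S k) * q k = 1 \/ p k * q (S k) - p (S k) * q k = -1)%Z.
Proof.
  pose proof (det_eq k). destruct (sgn_pm1 cf k) as [E|E]; rewrite E in *.
  - right. apply eq_IZR. lra.
  - left. apply eq_IZR. lra.
Qed.

(** The determinant being 1 or -1, (n, m) is an integral combination of two consecutive convergents
    with coefficients x and y. The bound on n forces x to be nonzero and y to be zero or of the
    opposite sign; as the errors alternate in sign, the two contributions add up. *)
Lemma best_approx k (n m : Z) : (n <> 0 \/ m <> 0)%Z -> (Z.abs n < q (S k))%Z ->
  D k <= Rabs (IZR n * theta - IZR m).
Proof.
  intros Hne Hn.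
  assert (exists x y : Z, n = x * q k + y * q (S k) /\ m = x * p k + y * p (S k))%Z as (x & y & Ex & Ey).
  { destruct (det_pm1 k) as [E|E].
    - exists (m * q (S k) - n * p (S k))%Z, (n * p k - m * q k)%Z.
      split; [rewrite <- (Z.mul_1_r n) at 1 | rewrite <- (Z.mul_1_r m) at 1]; rewrite <- E; ring.
    - exists (- (m * q (S k) - n * p (S k)))%Z, (- (n * p k - m * q k))%Z.
      split; [transitivity (- n * -1)%Z | transitivity (- m * -1)%Z];
        first [ring | rewrite <- E; ring]. }
  assert (E : IZR n * theta - IZR m = sg k * (IZR x * D k - IZR y * D (S k))).
  { subst n m. rewrite !plus_IZR, !mult_IZR.
    pose proof (err_eq cf k) as E1. pose proof (err_eq cf (S k)) as E2. rewrite sgn_S in E2.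
    transitivity (IZR x * (IZR (q k) * theta - IZR (p k)) + IZR y * (IZR (q (S k)) * theta - IZR (p (S k)))); [ring|].
    rewrite E1, E2. ring. }
  rewrite E, Rabs_mult. rewrite abs_sgn.
  rewrite Rmult_1_l.
  pose proof (den_ge1 k). pose proof (den_ge1 (S k)).
  pose proof (err_pos cf k). pose proof (err_pos cf (S k)).
  assert (Hc : (1 <= x /\ y <= 0 \/ x <= -1 /\ 0 <= y)%Z).
  { destruct (Z.lt_trichotomy x 0) as [Hx|[Hx|Hx]].
    - right. split; [lia|]. destruct (Z_lt_le_dec y 0); [|lia]. exfalso. nia.
    - subst x. exfalso. assert (y = 0)%Z by nia. subst y. lia.
    - left. split; [lia|]. destruct (Z_lt_le_dec 0 y); [|lia]. exfalso. nia. }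
  destruct Hc as [[Hx Hy]|[Hx Hy]]; apply IZR_le in Hx; apply IZR_le in Hy.
  - apply Rle_trans with (IZR x * D k - IZR y * D (S k)); [nra|apply Rle_abs].
  - rewrite <- Rabs_Ropp.
    apply Rle_trans with (- (IZR x * D k - IZR y * D (S k))); [nra|apply Rle_abs].
Qed.

(** Applied to differences of indices in [1, q_k], this separates the orbit points of level k. At k
    = 0 only n = 0 remains, and the gap is one between integers. *)
Lemma best_approx_half k (n m : Z) : (n <> 0 \/ m <> 0)%Z -> (Z.abs n < q k)%Z ->
  / (2 * IZR (q k)) <= Rabs (IZR n * theta - IZR m).
Proof.
  intros Hne Hn. destruct k as [|k].
  - rewrite den_0 in *. assert (n = 0%Z) by lia. subst n.
    rewrite Rmult_0_l, Rminus_0_l, Rabs_Ropp, Rabs_Zabs.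
    assert (1 <= Z.abs m)%Z as Hm by lia. apply IZR_le in Hm. lra.
  - apply Rle_trans with (D k); [apply err_ge|apply best_approx; assumption].
Qed.

(** Since p_k is invertible modulo q_k, n p_k - m q_k = j has a solution with n in [1, q_k]; the
    deviation is then n / q_k times the error of the convergent. So the orbit of level k shadows the
    grid of multiples of 1 / q_k. *)
Lemma orbit_near_rational k (j : Z) : exists n m : Z, (1 <= n <= q k)%Z /\
  Rabs (IZR n * theta - IZR m - IZR j / IZR (q k)) <= / IZR (q (S k)).
Proof.
  pose proof (den_ge1 k) as Hq.
  assert (exists n m : Z, (1 <= n <= q k /\ n * p k - m * q k = j)%Z) as (n & m & Hn & E).
  { assert (exists n m : Z, (n * p k - m * q k = j)%Z) as (n & m & E).
    { destruct (det_pm1 k) as [E|E].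
      - exists (j * q (S k))%Z, (j * p (S k))%Z. rewrite <- (Z.mul_1_r j) at 3. rewrite <- E. ring.
      - exists (- j * q (S k))%Z, (- j * p (S k))%Z.
        transitivity (- j * -1)%Z; [rewrite <- E|]; ring. }
    pose proof (Z.div_mod (n - 1) (q k) ltac:(lia)) as E2.
    pose proof (Z.mod_pos_bound (n - 1) (q k) ltac:(lia)) as B.
    exists (1 + (n - 1) mod q k)%Z, (m - (n - 1) / q k * p k)%Z. split; [lia|].
    rewrite <- E. generalize dependent ((n - 1) mod q k)%Z. generalize ((n - 1) / q k)%Z.
    intros u v E2 _. replace v with (n - 1 - q k * u)%Z by lia. ring. }
  exists n, m. split; [assumption|].
  apply (f_equal IZR) in E. rewrite minus_IZR, !mult_IZR in E.
  pose proof (err_eq cf k) as Ek. pose proof (den_IZR_ge1 k) as Hq1.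
  replace (IZR n * theta - IZR m - IZR j / IZR (q k)) with (sg k * (IZR n / IZR (q k) * D k)).
  2:{ rewrite <- E. transitivity (IZR n / IZR (q k) * (sg k * D k)); [ring|]. rewrite <- Ek. field; lra. }
  rewrite Rabs_mult. rewrite abs_sgn.
  pose proof (err_pos cf k). destruct Hn as [Hn1 Hn2]. apply IZR_le in Hn1, Hn2.
  assert (0 <= IZR n / IZR (q k) <= 1).
  { split; [apply Rmult_le_pos; [lra|]; left; apply Rinv_0_lt_compat; lra|].
    apply Rmult_le_reg_r with (IZR (q k)); [lra|]. field_simplify; lra. }
  rewrite Rmult_1_l, Rabs_pos_eq by nra.
  pose proof (err_le k). nra.
Qed.

End Convergents.

(** * Hausdorff null sets and finite covers *)

Lemma dist_int_le (x : R) (m : Z) : dist_int x <= Rabs (x - IZR m).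
Proof.
  unfold dist_int, frac_part. destruct (base_Int_part x) as [H1 H2].
  set (z := Int_part x) in *.
  destruct (Z_le_gt_dec m z) as [H|H].
  - apply IZR_le in H. eapply Rle_trans; [apply Rmin_l|].
    rewrite Rabs_pos_eq; lra.
  - assert (z + 1 <= m)%Z as H' by lia. apply IZR_le in H'. rewrite plus_IZR in H'.
    eapply Rle_trans; [apply Rmin_r|].
    rewrite Rabs_left1; lra.
Qed.

Lemma dist_int_attained (x : R) : exists m : Z, dist_int x = Rabs (x - IZR m).
Proof.
  unfold dist_int, frac_part. destruct (base_Int_part x) as [H1 H2].
  set (z := Int_part x) in *. unfold Rmin. destruct Rle_dec.
  - exists z. rewrite Rabs_pos_eq; lra.
  - exists (z + 1)%Z. rewrite plus_IZR, Rabs_left1; lra.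
Qed.

Definition approximable (tau theta y Q : R) : Prop :=
  exists n m : Z, (1 <= n)%Z /\ IZR n <= Q /\ Rabs (IZR n * theta - IZR m - y) < Rpower Q (- tau).

Lemma U_set_iff tau theta y :
  U_set tau theta y <-> in_torus y /\ exists Q0, forall Q, Q >= Q0 -> approximable tau theta y Q.
Proof.
  split; intros [Hy [Q0 HQ]]; split; auto; exists Q0; intros Q HQQ; destruct (HQ Q HQQ).
  - destruct H as (Hn & HnQ & Hd). destruct (dist_int_attained (INR x * theta - y)) as [m Em].
    exists (Z.of_nat x), m. rewrite <- INR_IZR_INZ. repeat split; [lia|assumption|].
    replace (INR x * theta - IZR m - y) with (INR x * theta - y - IZR m) by ring.
    rewrite <- Em. assumption.
  - destruct H as (m & Hn & HnQ & Hd).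
    exists (Z.to_nat x). rewrite INR_IZR_INZ, Z2Nat.id by lia. repeat split; [lia|assumption|].
    eapply Rle_lt_trans; [apply (dist_int_le _ m)|].
    replace (IZR x * theta - y - IZR m) with (IZR x * theta - IZR m - y) by ring. assumption.
Qed.

Lemma Rpower_pos x y : 0 < Rpower x y.
Proof. apply exp_pos. Qed.

Lemma null_subset s (E F : R -> Prop) :
  (forall x, E x -> F x) -> hausdorff_null s F -> hausdorff_null s E.
Proof.
  intros HEF H delta eps Hd He. destruct (H delta eps Hd He) as (a & b & H1 & H2 & H3).
  exists a, b. auto.
Qed.

Lemma Rpower_antimono_base_le1 x s s' : 0 < x <= 1 -> s <= s' -> Rpower x s' <= Rpower x s.
Proof.
  intros [H0 H1] Hs. unfold Rpower.
  assert (ln x <= 0) by (rewrite <- ln_1; destruct H1 as [H1| ->]; [left; apply ln_increasing; lra|right; reflexivity]).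
  destruct (Rle_lt_or_eq_dec (s' * ln x) (s * ln x)) as [Hlt|Heq]; [nra| |].
  - left. apply exp_increasing. assumption.
  - right. rewrite Heq. reflexivity.
Qed.

Lemma null_larger_exponent s s' E : s <= s' -> hausdorff_null s E -> hausdorff_null s' E.
Proof.
  intros Hs H delta eps Hd He.
  destruct (H (Rmin delta 1) eps) as (a & b & H1 & H2 & H3); [apply Rmin_glb_lt; lra|assumption|].
  exists a, b. split; [|split]; auto.
  - intro k. destruct (H1 k) as [Ha Hb]. pose proof (Rmin_l delta 1). split; lra.
  - intro N. eapply Rle_trans; [|apply (H3 N)]. apply sum_Rle. intros k _.
    destruct (H1 k) as [Ha Hb]. pose proof (Rmin_r delta 1).
    apply Rpower_antimono_base_le1; lra.
Qed.

(** * Double sums along the Cantor pairing, and countable unions of null sets *)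

Definition lsum {A} (g : A -> R) (l : list A) : R := fold_right (fun x acc => g x + acc) 0 l.

Lemma lsum_app {A} (g : A -> R) l l' : lsum g (l ++ l') = lsum g l + lsum g l'.
Proof. induction l; simpl; [ring|]. rewrite IHl. ring. Qed.

Lemma lsum_map {A B} (g : B -> R) (h : A -> B) l : lsum g (map h l) = lsum (fun x => g (h x)) l.
Proof. induction l; simpl; congruence. Qed.

Lemma lsum_seq (g : nat -> R) N : sum_f_R0 g N = lsum g (seq 0 (S N)).
Proof.
  induction N; [simpl; ring|]. rewrite seq_S, lsum_app, <- IHN. simpl. ring.
Qed.

Lemma lsum_nonneg {A} (g : A -> R) l : (forall x, 0 <= g x) -> 0 <= lsum g l.
Proof. intro Hg. induction l; simpl; [lra|]. specialize (Hg a). lra. Qed.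

Lemma lsum_incl {A} (g : A -> R) l l' :
  (forall x, 0 <= g x) -> NoDup l -> incl l l' -> lsum g l <= lsum g l'.
Proof.
  intros Hg Hnd. revert l'. induction Hnd as [|x l Hx Hnd IH]; intros l' Hi.
  - apply lsum_nonneg; assumption.
  - destruct (in_split x l' (Hi x (or_introl eq_refl))) as (l1 & l2 & ->).
    rewrite lsum_app. simpl.
    assert (lsum g l <= lsum g (l1 ++ l2)) as H.
    { apply IH. intros y Hy. specialize (Hi y (or_intror Hy)).
      apply in_app_or in Hi. apply in_or_app. destruct Hi as [Hi|[Hi|Hi]]; auto. congruence. }
    rewrite lsum_app in H. lra.
Qed.

Lemma lsum_prod {A B} (g : A * B -> R) l l' :
  lsum g (list_prod l l') = lsum (fun x => lsum (fun y => g (x, y)) l') l.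
Proof. induction l; simpl; [reflexivity|]. rewrite lsum_app, lsum_map, IHl. reflexivity. Qed.

Lemma cantor_of_nat_le k : (fst (of_nat k) <= k /\ snd (of_nat k) <= k)%nat.
Proof.
  pose proof (to_nat_non_decreasing (fst (of_nat k)) (snd (of_nat k))) as H.
  rewrite <- surjective_pairing, cancel_to_of in H. lia.
Qed.

Lemma lsum_ext {A} (g h : A -> R) l : (forall x, g x = h x) -> lsum g l = lsum h l.
Proof. intro H. induction l; simpl; congruence. Qed.

(** The first N + 1 pairs of the enumeration are distinct and lie in the square of side N + 1. *)
Lemma sum_cantor_le (g : nat -> nat -> R) N : (forall i j, 0 <= g i j) ->
  sum_f_R0 (fun k => g (fst (of_nat k)) (snd (of_nat k))) N <=
  sum_f_R0 (fun i => sum_f_R0 (g i) N) N.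
Proof.
  intro Hg. rewrite !lsum_seq.
  rewrite <- (lsum_map (fun x => g (fst x) (snd x)) of_nat).
  rewrite (lsum_ext _ (fun i => lsum (g i) (seq 0 (S N)))) by (intro; apply lsum_seq).
  rewrite <- (lsum_prod (fun x => g (fst x) (snd x))).
  apply lsum_incl.
  - auto.
  - apply NoDup_map_NoDup_ForallPairs; [|apply seq_NoDup].
    intros x y _ _ Hxy. rewrite <- (cancel_to_of x), <- (cancel_to_of y). congruence.
  - intros x Hx. apply in_map_iff in Hx. destruct Hx as (k & <- & Hk). apply in_seq in Hk.
    pose proof (cantor_of_nat_le k). rewrite (surjective_pairing (of_nat k)).
    apply in_prod; apply in_seq; lia.
Qed.

Lemma sum_half_pow_le N : sum_f_R0 (fun k => (/ 2) ^ (S k)) N <= 1.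
Proof.
  assert (sum_f_R0 (fun k => (/ 2) ^ (S k)) N = 1 - (/ 2) ^ (S N)) as ->.
  { induction N; [simpl; lra|]. rewrite tech5, IHN. simpl. lra. }
  pose proof (pow_lt (/ 2) (S N)). lra.
Qed.

Lemma null_union s (E : nat -> R -> Prop) :
  (forall K, hausdorff_null s (E K)) -> hausdorff_null s (fun x => exists K, E K x).
Proof.
  intros H delta eps Hd He.
  assert (Hpos : forall K, 0 < eps * (/ 2) ^ (S K)) by (intro K; apply Rmult_lt_0_compat; [assumption|apply pow_lt; lra]).
  assert (forall K, exists ab : (nat -> R) * (nat -> R),
      (forall k, fst ab k < snd ab k /\ snd ab k - fst ab k <= delta) /\
      (forall x, E K x -> exists k, fst ab k <= x <= snd ab k) /\
      (forall N, sum_f_R0 (fun k => Rpower (snd ab k - fst ab k) s) N <= eps * (/ 2) ^ (S K))) as H'.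
  { intro K. destruct (H K delta _ Hd (Hpos K)) as (a & b & Hab). exists (a, b). exact Hab. }
  set (ab := fun K => proj1_sig (constructive_indefinite_description _ (H' K))).
  assert (Hab := fun K => proj2_sig (constructive_indefinite_description _ (H' K))). fold (ab) in Hab.
  change (forall K, (fun ab0 => (forall k, fst ab0 k < snd ab0 k /\ snd ab0 k - fst ab0 k <= delta) /\
      (forall x, E K x -> exists k, fst ab0 k <= x <= snd ab0 k) /\
      (forall N, sum_f_R0 (fun k => Rpower (snd ab0 k - fst ab0 k) s) N <= eps * (/ 2) ^ (S K))) (ab K)) in Hab.
  cbv beta in Hab.
  exists (fun k => fst (ab (fst (of_nat k))) (snd (of_nat k))),
         (fun k => snd (ab (fst (of_nat k))) (snd (of_nat k))).
  split; [|split].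
  - intro k. apply Hab.
  - intros x (K & Hx). destruct (Hab K) as (_ & H2 & _). destruct (H2 x Hx) as [k Hk].
    exists (to_nat (K, k)). rewrite cancel_of_to. exact Hk.
  - intro N. eapply Rle_trans.
    { apply (sum_cantor_le (fun i j => Rpower (snd (ab i) j - fst (ab i) j) s)).
      intros; left; apply Rpower_pos. }
    eapply Rle_trans; [apply sum_Rle; intros i _; apply (proj2 (proj2 (Hab i)))|].
    rewrite (sum_eq _ (fun i => (/ 2) ^ S i * eps)) by (intros; apply Rmult_comm).
    rewrite <- scal_sum. pose proof (sum_half_pow_le N). nra.
Qed.

(** * Finite covers by intervals of equal length *)

Definition covered (E : R -> Prop) (M L : R) : Prop :=
  exists l : list R, INR (length l) <= M /\ forall x, E x -> exists a, In a l /\ a <= x <= a + L.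

Lemma covered_weaken E M L M' L' : M <= M' -> L <= L' -> covered E M L -> covered E M' L'.
Proof.
  intros HM HL (l & Hl & Hc). exists l. split; [lra|].
  intros x Hx. destruct (Hc x Hx) as (a & Ha & Hax). exists a. split; [assumption|lra].
Qed.

Lemma covered_subset (E F : R -> Prop) M L : (forall x, E x -> F x) -> covered F M L -> covered E M L.
Proof. intros H (l & Hl & Hc). exists l. auto. Qed.

Lemma covered_refine (E F : R -> Prop) M L L' (K : nat) :
  (forall a, exists l, (length l <= K)%nat /\ forall x, F x -> a <= x <= a + L -> exists a', In a' l /\ a' <= x <= a' + L') ->
  covered E M L -> covered (fun x => E x /\ F x) (M * INR K) L'.
Proof.
  intros H (l & Hl & Hc).
  assert (exists l', (length l' <= length l * K)%nat /\ forall x, F x -> (exists a, In a l /\ a <= x <= a + L) -> exists a', In a' l' /\ a' <= x <= a' + L')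
    as (l' & Hl' & Hc').
  { clear Hl Hc. induction l as [|a l IH].
    - exists nil. split; [reflexivity|]. intros x _ (a & [] & _).
    - destruct IH as (l1 & Hl1 & Hc1). destruct (H a) as (l2 & Hl2 & Hc2).
      exists (l2 ++ l1). rewrite length_app. split; [simpl; lia|].
      intros x Hx (b & [<-|Hb] & Hbx).
      + destruct (Hc2 x Hx Hbx) as (a' & ? & ?). exists a'. split; [apply in_or_app; auto|assumption].
      + destruct (Hc1 x Hx (ex_intro _ b (conj Hb Hbx))) as (a' & ? & ?).
        exists a'. split; [apply in_or_app; auto|assumption]. }
  exists l'. split.
  - apply le_INR in Hl'. rewrite mult_INR in Hl'. pose proof (pos_INR K). nra.
  - intros x [Hx HF]. destruct (Hc x Hx) as (a & Ha). apply Hc'; eauto.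
Qed.

Lemma covered_split E M L L' (K : nat) : L <= INR K * L' -> 0 < L' -> (1 <= K)%nat ->
  covered E M L -> covered E (M * INR K) L'.
Proof.
  intros HL HL' HK Hc. apply covered_subset with (fun x => E x /\ True); [auto|].
  revert Hc. apply covered_refine. intro a.
  exists (map (fun i => a + INR i * L') (seq 0 K)). rewrite length_map, length_seq. split; [lia|].
  intros x _ Hx.
  assert (exists i, (i < K)%nat /\ a + INR i * L' <= x <= a + INR i * L' + L') as (i & Hi & Hix).
  { clear E M. revert L HL Hx. induction K as [|K IH]; [lia|]. intros L HL Hx.
    destruct (Rle_lt_dec (a + INR K * L') x) as [Hge|Hlt].
    - exists K. rewrite S_INR in HL. split; [lia|]. lra.
    - destruct K; [simpl in Hlt; lra|].
      destruct (IH ltac:(lia) (INR (S K) * L') ltac:(lra)) as (i & ? & ?); [lra|].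
      exists i. split; [lia|assumption]. }
  exists (a + INR i * L'). split; [|assumption].
  apply in_map_iff. exists i. split; [reflexivity|]. apply in_seq. lia.
Qed.

(* A half-open cell of length [sigma] holds at most one point of [P]. *)
Lemma covered_separated (E P : R -> Prop) M L rho sigma (K : nat) :
  (forall x y, P x -> P y -> x <> y -> sigma <= Rabs (x - y)) ->
  0 < sigma -> L + 2 * rho < INR K * sigma -> covered E M L ->
  covered (fun y => E y /\ exists x, P x /\ Rabs (x - y) <= rho) (M * INR K) (2 * rho).
Proof.
  intros Hsep Hs HK. apply covered_refine. intro a.
  (* The relevant centres lie in the window from a - rho to a + L + rho, which is cut into K cells
     of length sigma. *)
  set (P' := fun i x => P x /\ a - rho + INR i * sigma <= x < a - rho + INR (S i) * sigma).
  assert (exists l, (length l <= K)%nat /\ forall i x, (i < K)%nat -> P' i x -> In (x - rho) l) as (l & Hl & Hc).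
  { clear HK. induction K as [|K IH].
    - exists nil. split; [reflexivity|]. intros; lia.
    - destruct IH as (l & Hl & Hc). destruct (classic (exists x, P' K x)) as [[x Hx]|Hno].
      + exists ((x - rho) :: l). split; [simpl; lia|]. intros i y Hi Hy.
        destruct (Nat.eq_dec i K) as [->|Hne].
        * left. destruct (Req_dec x y) as [->|Hxy]; [reflexivity|]. exfalso.
          destruct Hx as [Hx1 Hx2], Hy as [Hy1 Hy2]. rewrite S_INR in *.
          specialize (Hsep x y Hx1 Hy1 Hxy). revert Hsep. unfold Rabs. destruct Rcase_abs; lra.
        * right. apply (Hc i); [lia|assumption].
      + exists l. split; [lia|]. intros i y Hi Hy.
        destruct (Nat.eq_dec i K) as [->|Hne]; [exfalso; eauto|]. apply (Hc i); [lia|assumption]. }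
  exists l. split; [assumption|]. intros y (x & HP & Hxy) Hy.
  assert (x - rho <= y <= x + rho) as Hxy'.
  { revert Hxy. unfold Rabs. destruct Rcase_abs; lra. }
  assert (exists i, (i < K)%nat /\ P' i x) as (i & Hi & HPi).
  { assert (Hx : a - rho <= x < a - rho + INR K * sigma) by lra.
    clear HK Hl Hc. induction K as [|K IH]; [simpl in Hx; lra|].
    destruct (Rle_lt_dec (a - rho + INR K * sigma) x).
    - exists K. split; [lia|]. split; [assumption|lra].
    - destruct IH as (i & ? & ?); [lra|]. exists i. split; [lia|assumption]. }
  exists (x - rho). split; [eauto|lra].
Qed.

Lemma covered_null E s : 0 < s ->
  (forall delta eps, 0 < delta -> 0 < eps ->
     exists M L, 0 < L <= delta /\ covered E M L /\ M * Rpower L s <= eps) ->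
  hausdorff_null s E.
Proof.
  intros Hs H delta eps Hd He.
  destruct (H delta (eps / 2) Hd ltac:(lra)) as (M & L & HL & (l & Hl & Hc) & HM).
  (* the finite cover is padded with intervals of length [pad k], so short that their total weight is at most [eps / 2] *)
  set (pad := fun k : nat => Rmin delta (Rpower (eps / 2 * (/ 2) ^ (S k)) (/ s))).
  assert (Hpw : forall k, 0 < eps / 2 * (/ 2) ^ (S k)).
  { intro k. apply Rmult_lt_0_compat; [lra|]. apply pow_lt; lra. }
  assert (Hpad : forall k, 0 < pad k) by (intro k; apply Rmin_glb_lt; [assumption|apply Rpower_pos]).
  assert (Hpads : forall k, Rpower (pad k) s <= eps / 2 * (/ 2) ^ (S k)).
  { intro k. apply Rle_trans with (Rpower (Rpower (eps / 2 * (/ 2) ^ (S k)) (/ s)) s).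
    - apply Rle_Rpower_l; [lra|]. split; [apply Hpad|apply Rmin_r].
    - rewrite Rpower_mult, Rinv_l, Rpower_1; [lra|apply Hpw|lra]. }
  set (n := length l).
  exists (fun k => if lt_dec k n then nth k l 0 else 0),
         (fun k => if lt_dec k n then nth k l 0 + L else pad k).
  split; [|split].
  - intro k. destruct lt_dec; [lra|]. pose proof (Hpad k). pose proof (Rmin_l delta (Rpower (eps / 2 * (/ 2) ^ (S k)) (/ s))).
    fold (pad k) in *. lra.
  - intros x Hx. destruct (Hc x Hx) as (a & Ha & Hax).
    destruct (In_nth l a 0 Ha) as (k & Hk & <-). exists k. unfold n. destruct lt_dec; [assumption|lia].
  - intro N.
    assert (forall N, sum_f_R0 (fun k => if lt_dec k n then Rpower L s else 0) N <= INR n * Rpower L s) as Hf.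
    { clear. intro N. pose proof (Rpower_pos L s).
      assert (sum_f_R0 (fun k => if lt_dec k n then Rpower L s else 0) N = INR (Nat.min (S N) n) * Rpower L s) as ->.
      { induction N as [|N IH].
        - simpl sum_f_R0. destruct lt_dec.
          + rewrite Nat.min_l by lia. simpl; ring.
          + rewrite Nat.min_r by lia. replace n with 0%nat by lia. simpl; ring.
        - rewrite tech5, IH. destruct lt_dec.
          + rewrite !Nat.min_l by lia. rewrite (S_INR (S N)). ring.
          + rewrite !Nat.min_r by lia. ring. }
      apply Rmult_le_compat_r; [lra|]. apply le_INR. lia. }
    apply Rle_trans with (sum_f_R0 (fun k => (if lt_dec k n then Rpower L s else 0) + (/ 2) ^ (S k) * (eps / 2)) N).
    + apply sum_Rle. intros k _. destruct lt_dec.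
      * replace (nth k l 0 + L - nth k l 0) with L by ring. specialize (Hpw k). lra.
      * rewrite Rminus_0_r. specialize (Hpads k). lra.
    + rewrite plus_sum, <- scal_sum. specialize (Hf N). pose proof (sum_half_pow_le N).
      pose proof (Rpower_pos L s). fold n in Hl. nra.
Qed.

(** * Upper bounds for the dimension *)

Lemma exp_le x y : x <= y -> exp x <= exp y.
Proof. intros [H| ->]; [left; apply exp_increasing; assumption|right; reflexivity]. Qed.

Lemma ln_le x y : 0 < x -> x <= y -> ln x <= ln y.
Proof. intros Hx [H| ->]; [left; apply ln_increasing; assumption|right; reflexivity]. Qed.

Lemma Rpower_exp u v : Rpower (exp u) v = exp (v * u).
Proof. unfold Rpower. rewrite ln_exp. reflexivity. Qed.

Lemma exp_ge_of_ln_le r x : 0 < r -> ln r <= x -> r <= exp x.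
Proof. intros Hr H. rewrite <- (exp_ln r Hr). apply exp_le, H. Qed.

Lemma exp_le_of_le_ln r x : 0 < r -> x <= ln r -> exp x <= r.
Proof. intros Hr H. rewrite <- (exp_ln r Hr). apply exp_le, H. Qed.

Fixpoint psum (f : nat -> R) (k : nat) : R :=
  match k with O => 0 | S k => psum f k + f k end.

(** At a frequent level the total weight is at most C 4^s' exp (- (s' - s) mu_k), so the gap between
    s and s' absorbs every constant. The factor 4 is the diameter of a cluster of radius 2 exp (- c
    b_k). *)
Lemma null_of_frequent_covers E (V mu : nat -> R) s s' C :
  0 <= s < s' -> 0 < C ->
  (forall B, exists K, forall k, (K <= k)%nat -> B <= mu k) ->
  (forall K, exists k, (K <= k)%nat /\ V k <= s * mu k) ->
  (exists K, forall k, (K <= k)%nat -> covered E (C * exp (V k)) (4 * exp (- mu k))) ->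
  hausdorff_null s' E.
Proof.
  intros Hs HC Hmu Hfr [K0 Hcov]. apply covered_null; [lra|].
  intros delta eps Hd He.
  destruct (Hmu (Rmax (- ln (delta / 4)) (- ln (eps / (C * Rpower 4 s')) / (s' - s)))) as [K1 HK1].
  destruct (Hfr (max K0 K1)) as (k & Hk & HV). specialize (HK1 k ltac:(lia)).
  specialize (Hcov k ltac:(lia)).
  assert (HC4 : 0 < C * Rpower 4 s') by (apply Rmult_lt_0_compat; [assumption|apply Rpower_pos]).
  assert (Hm1 : exp (- mu k) <= delta / 4).
  { apply exp_le_of_le_ln; [lra|]. pose proof (Rmax_l (- ln (delta / 4)) (- ln (eps / (C * Rpower 4 s')) / (s' - s))). lra. }
  assert (Hm2 : - (s' - s) * mu k <= ln (eps / (C * Rpower 4 s'))).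
  { pose proof (Rmax_r (- ln (delta / 4)) (- ln (eps / (C * Rpower 4 s')) / (s' - s))) as H.
    assert (H' : - ln (eps / (C * Rpower 4 s')) / (s' - s) <= mu k) by lra.
    apply Rmult_le_compat_l with (r := s' - s) in H'; [|lra].
    replace ((s' - s) * (- ln (eps / (C * Rpower 4 s')) / (s' - s))) with (- ln (eps / (C * Rpower 4 s'))) in H' by (field; lra). lra. }
  exists (C * exp (V k)), (4 * exp (- mu k)). pose proof (exp_pos (- mu k)). repeat split; [lra|lra|assumption|].
  rewrite <- Rpower_mult_distr by lra.
  rewrite Rpower_exp.
  replace (C * exp (V k) * (Rpower 4 s' * exp (s' * - mu k)))
    with (C * Rpower 4 s' * exp (V k + s' * - mu k)) by (rewrite exp_plus; ring).
  assert (exp (V k + s' * - mu k) <= eps / (C * Rpower 4 s')) as Hle.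
  { apply exp_le_of_le_ln; [apply Rdiv_lt_0_compat; assumption|]. lra. }
  apply Rmult_le_compat_l with (r := C * Rpower 4 s') in Hle; [|lra].
  replace (C * Rpower 4 s' * (eps / (C * Rpower 4 s'))) with eps in Hle; [assumption|].
  field; split; lra || (pose proof (Rpower_pos 4 s'); lra).
Qed.

(** * Orbit points and clusters on the logarithmic scale *)

Section Logs.
Variables (theta : R) (cf : convergents theta).
Local Notation q := (den cf).
Local Notation p := (numer cf).
Local Notation D := (err cf).
Local Notation sg := (sgn cf).

Definition lden (k : nat) : R := ln (IZR (q k)).
Local Notation a := lden.
Definition lden2 (k : nat) : R := a k + a (S k).
Local Notation b := lden2.

Lemma exp_lden k : exp (a k) = IZR (q k).
Proof. apply exp_ln. pose proof (den_IZR_ge1 _ cf k). lra. Qed.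

Lemma exp_neg_lden k : exp (- a k) = / IZR (q k).
Proof. rewrite exp_Ropp, exp_lden. reflexivity. Qed.

Lemma lden_ge0 k : 0 <= a k.
Proof. rewrite <- ln_1. apply ln_le; [lra|apply den_IZR_ge1]. Qed.

Lemma lden_mono j k : (j <= k)%nat -> a j <= a k.
Proof.
  intro H. apply ln_le; [pose proof (den_IZR_ge1 _ cf j); lra|]. apply IZR_le, den_mono, H.
Qed.

Lemma lden_S k : a k <= a (S k).
Proof. apply lden_mono. lia. Qed.

Lemma lden_unbounded B : exists K, forall k, (K <= k)%nat -> B <= a k.
Proof.
  destruct (archimed (exp B)) as [H _]. set (z := up (exp B)) in *.
  exists (S (Z.to_nat z)). intros k Hk.
  rewrite <- (ln_exp B). apply ln_le; [apply exp_pos|].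
  assert (z <= q k)%Z.
  { apply Z.le_trans with (q (S (Z.to_nat z))); [|apply den_mono; assumption].
    pose proof (den_ge_index _ cf (Z.to_nat z)). lia. }
  apply IZR_le in H0. lra.
Qed.

Lemma lden2_unbounded c B : 0 < c -> exists K, forall k, (K <= k)%nat -> B <= c * b k.
Proof.
  intro Hc. destruct (lden_unbounded (B / c)) as [K HK]. exists K. intros k Hk.
  specialize (HK k Hk). pose proof (lden_ge0 (S k)). unfold lden2.
  apply Rmult_le_compat_l with (r := c) in HK; [|lra].
  replace (c * (B / c)) with B in HK by (field; lra). nra.
Qed.

Lemma lden2_ge0 k : 0 <= b k.
Proof. unfold lden2. pose proof (lden_ge0 k). pose proof (lden_ge0 (S k)). lra. Qed.

(** For c <= 1/2 the cluster radius exp (- c b_k) is at least 1 / q_{k+1}; for c >= 1/2, in the next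
    lemma, it is at most 1 / q_k. Both hold because b_k / 2 is the mean of a_k and a_{k+1}. *)
Lemma lden2_le_lden_S c k : 0 <= c <= 1 / 2 -> c * b k <= a (S k).
Proof.
  intro Hc. pose proof (lden2_ge0 k). pose proof (lden_S k).
  apply Rle_trans with (1 / 2 * b k); [nra|]. unfold lden2. lra.
Qed.

Lemma lden_le_lden2 c k : 1 / 2 <= c -> a k <= c * b k.
Proof.
  intro Hc. pose proof (lden2_ge0 k). pose proof (lden_S k).
  apply Rle_trans with (1 / 2 * b k); [unfold lden2; lra|nra].
Qed.

Lemma lden2_mul_le c c' k : c <= c' -> c * b k <= c' * b k.
Proof. intro Hc. apply Rmult_le_compat_r; [apply lden2_ge0|assumption]. Qed.

Lemma err_le_exp k : D k <= exp (- a (S k)).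
Proof. rewrite exp_neg_lden. apply err_le. Qed.

Lemma err_ge_exp k : exp (- a (S k)) / 2 <= D k.
Proof.
  rewrite exp_neg_lden. eapply Rle_trans; [|apply err_ge]. rewrite Rinv_mult. lra.
Qed.

Definition orbit_pt (k : nat) (x : R) : Prop :=
  exists n m : Z, (1 <= n <= q k)%Z /\ x = IZR n * theta - IZR m.

Lemma orbit_pt_separated k x y : orbit_pt k x -> orbit_pt k y -> x <> y ->
  exp (- a k) / 2 <= Rabs (x - y).
Proof.
  intros (n & m & Hn & ->) (n' & m' & Hn' & ->) Hne.
  replace (IZR n * theta - IZR m - (IZR n' * theta - IZR m')) with (IZR (n - n') * theta - IZR (m - m'))
    by (rewrite !minus_IZR; ring).
  eapply Rle_trans; [|apply (best_approx_half _ cf k)].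
  - rewrite exp_neg_lden, Rinv_mult. lra.
  - destruct (Z.eq_dec n n') as [->|Hnn]; [|left; lia]. right. intro. apply Hne. assert (m' = m) by lia. subst. reflexivity.
  - lia.
Qed.

Definition near_orbit (k : nat) (r y : R) : Prop := exists x, orbit_pt k x /\ Rabs (x - y) <= r.

(** The index n is reduced modulo q_k into [1, q_k]; the drift this causes is at most exp ((1 - c)
    b_k - b_k), the same size as the approximation error, whence the factor 2. *)
Lemma approximable_near_orbit tau c k y :
  c * (1 + tau) = tau ->
  approximable tau theta y (exp ((1 - c) * b k)) -> near_orbit k (2 * exp (- c * b k)) y.
Proof.
  intros Hc (n & m & Hn & HnQ & Hd).
  rewrite Rpower_exp in Hd. replace (- tau * ((1 - c) * b k)) with (- c * b k) in Hd by (replace c with (tau * (1 - c)) at 1 by lra; ring).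
  pose proof (den_ge1 _ cf k) as Hq.
  pose proof (Z.div_mod (n - 1) (q k) ltac:(lia)) as E.
  pose proof (Z.mod_pos_bound (n - 1) (q k) ltac:(lia)) as Hb.
  assert (0 <= (n - 1) / q k)%Z as Hu by (apply Z.div_pos; lia).
  generalize dependent ((n - 1) mod q k)%Z. generalize dependent ((n - 1) / q k)%Z. intros u Hu v E Hv.
  exists (IZR (v + 1) * theta - IZR (m - u * p k)). split; [exists (v + 1)%Z, (m - u * p k)%Z; split; [lia|reflexivity]|].
  replace (v + 1)%Z with (n - u * q k)%Z by lia.
  rewrite !minus_IZR, !mult_IZR.
  replace ((IZR n - IZR u * IZR (q k)) * theta - (IZR m - IZR u * IZR (p k)) - y)
    with ((IZR n * theta - IZR m - y) - IZR u * (IZR (q k) * theta - IZR (p k))) by ring.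
  rewrite err_eq. unfold Rminus at 1. eapply Rle_trans; [apply Rabs_triang|].
  rewrite Rabs_Ropp, !Rabs_mult, abs_sgn, Rmult_1_l.
  apply IZR_le in Hu. pose proof (err_pos cf k).
  rewrite (Rabs_pos_eq (IZR u)), (Rabs_pos_eq (D k)) by lra.
  assert (IZR u * D k <= exp (- c * b k)); [|lra].
  assert (IZR u * IZR (q k) <= exp ((1 - c) * b k)).
  { rewrite <- mult_IZR. eapply Rle_trans; [|apply HnQ]. apply IZR_le. lia. }
  apply Rle_trans with (exp ((1 - c) * b k) * exp (- a k) * exp (- a (S k))).
  - pose proof (err_le_exp k). rewrite <- exp_lden in H0.
    pose proof (exp_pos (- a k)).
    apply Rmult_le_compat; [assumption|lra| |assumption].
    replace (IZR u) with (IZR u * exp (a k) * exp (- a k)); [nra|].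
    rewrite Rmult_assoc, <- exp_plus. replace (a k + - a k) with 0 by ring. rewrite exp_0. ring.
  - rewrite <- !exp_plus. apply exp_le. unfold lden2. lra.
Qed.

Lemma approximable_near_orbit_den tau k y :
  approximable tau theta y (exp (a k)) -> near_orbit k (exp (- tau * a k)) y.
Proof.
  intros (n & m & Hn & HnQ & Hd). rewrite exp_lden in HnQ. apply le_IZR in HnQ.
  rewrite Rpower_exp in Hd.
  exists (IZR n * theta - IZR m). split; [exists n, m; auto|lra].
Qed.

(** Uniform approximability tested at two scales per level, Q = exp ((1 - c) b_k) and Q = q_k, with
    a threshold K common to all points so that countably many such sets exhaust [U_set]. *)
Definition well_approx_from (tau c : R) (K : nat) (y : R) : Prop :=
  in_torus y /\ forall k, (K <= k)%nat ->
    near_orbit k (2 * exp (- c * b k)) y /\ near_orbit k (exp (- tau * a k)) y.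

Lemma U_set_well_approx tau c y : c < 1 -> c * (1 + tau) = tau ->
  U_set tau theta y -> exists K, well_approx_from tau c K y.
Proof.
  intros Hc1 Hc Hy. apply U_set_iff in Hy. destruct Hy as [Hy [Q0 HQ]].
  destruct (lden2_unbounded (1 - c) (ln (Rmax 1 Q0)) ltac:(lra)) as [K1 HK1].
  destruct (lden_unbounded (ln (Rmax 1 Q0))) as [K2 HK2].
  pose proof (Rmax_l 1 Q0). pose proof (Rmax_r 1 Q0).
  exists (max K1 K2). split; [assumption|]. intros k Hk. split.
  - apply (approximable_near_orbit tau); [assumption|]. apply HQ. apply Rle_ge.
    apply Rle_trans with (Rmax 1 Q0); [assumption|]. apply exp_ge_of_ln_le; [lra|]. apply HK1; lia.
  - apply approximable_near_orbit_den. apply HQ. apply Rle_ge.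
    apply Rle_trans with (Rmax 1 Q0); [assumption|]. apply exp_ge_of_ln_le; [lra|]. apply HK2; lia.
Qed.

Lemma well_approx_from_weaken tau c K K' y : (K <= K')%nat -> well_approx_from tau c K y -> well_approx_from tau c K' y.
Proof. intros HK [Hy H]. split; [assumption|]. intros k Hk. apply H. lia. Qed.

Lemma U_null_of_levels tau c s : c < 1 -> c * (1 + tau) = tau ->
  (exists K0, forall K, (K0 <= K)%nat -> hausdorff_null s (well_approx_from tau c K)) ->
  hausdorff_null s (U_set tau theta).
Proof.
  intros Hc1 Hc [K0 H]. apply null_subset with (fun y => exists K, well_approx_from tau c K y).
  - intros y Hy. apply (U_set_well_approx tau c); assumption.
  - apply null_union. intro K. apply null_subset with (well_approx_from tau c (max K0 K)).
    + intro y. apply well_approx_from_weaken. lia.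
    + apply H. lia.
Qed.

Lemma exists_nat_between x : 0 <= x -> exists K : nat, (1 <= K)%nat /\ x < INR K <= x + 1.
Proof.
  intro Hx. destruct (archimed x) as [H1 H2]. exists (Z.to_nat (up x)).
  assert (0 < up x)%Z by (apply lt_IZR; lra).
  rewrite INR_IZR_INZ, Z2Nat.id by lia. split; [lia|lra].
Qed.

(** Orbit points of level k are at least 1 / (2 q_k) apart, so at most 2 (L + 2 r) q_k + 1 of them
    come within r of an interval of length L. *)
Lemma covered_near_orbit E k M L r x :
  0 <= x -> (L + 2 * r) * 2 <= x * exp (- a k) -> 0 <= M -> covered E M L ->
  covered (fun y => E y /\ near_orbit k r y) (M * (x + 1)) (2 * r).
Proof.
  intros Hx HL HM Hc. destruct (exists_nat_between x Hx) as (K & HK & HK1 & HK2).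
  apply covered_weaken with (M * INR K) (2 * r); [apply Rmult_le_compat_l; lra|lra|].
  pose proof (exp_pos (- a k)).
  apply (covered_separated _ (orbit_pt k) M L r (exp (- a k) / 2)); [apply orbit_pt_separated|lra| |assumption].
  nra.
Qed.

Lemma covered_near_orbit_single E k M L r :
  (L + 2 * r) * 2 < exp (- a k) -> covered E M L ->
  covered (fun y => E y /\ near_orbit k r y) M (2 * r).
Proof.
  intros HL Hc. rewrite <- (Rmult_1_r M). change 1 with (INR 1).
  pose proof (exp_pos (- a k)).
  apply (covered_separated _ (orbit_pt k) M L r (exp (- a k) / 2)); [apply orbit_pt_separated|lra| |assumption].
  simpl. lra.
Qed.

(* [V_lo], [mu_lo] are the V_k(c), mu_k(c) of the header for tau < 1, and [V_hi], [mu_hi] those for tau > 1. *)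
Definition V_lo (c : R) (k : nat) : R := a k - psum (fun j => Rmax 0 (c * b j - a j)) k.
Definition mu_lo (c : R) (k : nat) : R := Rmax (a k) (c * b k).
Definition V_hi (c : R) (k : nat) : R := psum (fun j => Rmax 0 (a (S j) - c * b j)) k.
Definition mu_hi (c : R) (k : nat) : R := Rmax (c / (1 - c) * a k) (c * b k).

(** * Covers below the exponent 1 *)

Lemma mu_lo_unbounded c B : exists K, forall k, (K <= k)%nat -> B <= mu_lo c k.
Proof.
  destruct (lden_unbounded B) as [K HK]. exists K. intros k Hk.
  eapply Rle_trans; [apply HK, Hk|apply Rmax_l].
Qed.

Lemma torus_covered : covered in_torus 1 1.
Proof.
  exists (0 :: nil). split; [simpl; lra|]. intros x [H1 H2]. exists 0. split; [left; reflexivity|lra].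
Qed.

(** Total length M L is the right quantity to follow: it is unchanged at levels whose clusters
    merge, and elsewhere it is multiplied by about q_k exp (- c b_k). The invariant L >= 1 / q_k
    lets the count L q_k absorb the additive 1 of each refinement. *)
Lemma cover_lo tau c c' : 0 < c' < c -> c < 1 / 2 ->
  exists K0, forall K k, (K0 <= K)%nat -> (K <= k)%nat ->
  exists M L, 0 <= M /\ exp (- a k) <= L /\
    M * L <= exp (psum (fun j => Rmax 0 (c' * b j - a j)) K - psum (fun j => Rmax 0 (c' * b j - a j)) k) /\
    covered (well_approx_from tau c K) M L.
Proof.
  (* 48 = 12 * 4: an interval is replaced by at most 12 L q_k clusters, each of length 4 exp (- c
     b_k). Passing from c to c' pays for this at every level. *)
  intros Hc Hc2. destruct (lden2_unbounded (c - c') (ln 48) ltac:(lra)) as [K0 HK0].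
  exists K0. intros K k HK0K HKk. induction HKk as [|k Hk IH].
  - exists 1, 1. rewrite Rminus_diag, exp_0. repeat split; try lra.
    + rewrite <- exp_0. apply exp_le. pose proof (lden_ge0 K). lra.
    + apply covered_subset with in_torus; [intros y Hy; apply Hy|apply torus_covered].
  - destruct IH as (M & L & HM & HL & HML & Hcov). cbn [psum]. set (S1 := psum _ K) in *. set (S2 := psum _ k) in *.
    destruct (Rle_lt_dec (c' * b k) (a k)) as [Hun|Hsel].
    + exists M, L. rewrite Rmax_left by lra. rewrite Rplus_0_r. repeat split; auto.
      eapply Rle_trans; [|apply HL]. apply exp_le. pose proof (lden_S k). lra.
    + specialize (HK0 k ltac:(lia)).
      assert (Hlk : exp (- c * b k) <= exp (- a k)) by (apply exp_le; pose proof (lden2_mul_le c' c k ltac:(lra)); lra).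
      pose proof (exp_pos (- c * b k)). pose proof (exp_pos (- a k)).
      assert (Hea : exp (a k) * exp (- a k) = 1) by (rewrite <- exp_plus, Rplus_opp_r; apply exp_0).
      pose proof (exp_pos (a k)).
      assert (HL1 : 1 <= L * exp (a k)) by nra.
      exists (M * (12 * (L * exp (a k)))), (4 * exp (- c * b k)). repeat split.
      * nra.
      * apply Rle_trans with (exp (- c * b k)); [|lra]. apply exp_le. pose proof (lden2_le_lden_S c k ltac:(lra)). lra.
      * rewrite Rmax_right by lra.
        replace (S1 - (S2 + (c' * b k - a k))) with ((S1 - S2) + (a k - c' * b k)) by ring.
        rewrite exp_plus.
        replace (M * (12 * (L * exp (a k))) * (4 * exp (- c * b k))) with ((M * L) * (48 * (exp (a k) * exp (- c * b k)))) by ring.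
        apply Rmult_le_compat; [nra| |assumption|].
        -- pose proof (exp_pos (a k)). nra.
        -- rewrite <- exp_plus, <- (exp_ln 48), <- exp_plus by lra. apply exp_le. lra.
      * apply covered_weaken with (M * (10 * (L * exp (a k)) + 1)) (2 * (2 * exp (- c * b k))); [nra|lra|].
        apply covered_subset with (fun y => well_approx_from tau c K y /\ near_orbit k (2 * exp (- c * b k)) y).
        { intros y Hy. split; [assumption|]. apply Hy. assumption. }
        apply covered_near_orbit with L; [nra| |assumption|assumption].
        replace (10 * (L * exp (a k)) * exp (- a k)) with (10 * L) by (transitivity (10 * L * (exp (a k) * exp (- a k))); [rewrite Hea|]; ring).
        lra.
Qed.

(** The two values of the maximum in [mu_lo] are two ways to finish the cover: chop its intervals to
    length 1 / q_k, or refine once more to the clusters of level k. The number of pieces is about M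
    L q_k in both cases. *)
Lemma U_null_lo tau c c' s s' : 0 < c' < c -> c < 1 / 2 -> c * (1 + tau) = tau -> 0 <= s < s' ->
  (forall K, exists k, (K <= k)%nat /\ V_lo c' k <= s * mu_lo c' k) ->
  hausdorff_null s' (U_set tau theta).
Proof.
  intros Hc Hc2 Htau Hs Hfr. apply (U_null_of_levels tau c); [lra|assumption|].
  destruct (cover_lo tau c c' Hc Hc2) as [K0 Hcov]. exists K0. intros K HK.
  set (f := fun j => Rmax 0 (c' * b j - a j)) in *.
  apply null_of_frequent_covers with (V_lo c') (mu_lo c') s (12 * exp (psum f K)); auto.
  - pose proof (exp_pos (psum f K)). lra.
  - apply mu_lo_unbounded.
  - exists K. intros k Hk. destruct (Hcov K k HK Hk) as (M & L & HM & HL & HML & Hc3).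
    unfold V_lo, mu_lo. fold f.
    assert (Hea : exp (a k) * exp (- a k) = 1) by (rewrite <- exp_plus, Rplus_opp_r; apply exp_0).
    pose proof (exp_pos (a k)). pose proof (exp_pos (- a k)).
    assert (HL1 : 1 <= L * exp (a k)) by nra.
    assert (HB : M * (12 * (L * exp (a k))) <= 12 * exp (psum f K) * exp (a k - psum f k)).
    { replace (12 * exp (psum f K) * exp (a k - psum f k)) with (12 * exp (a k) * exp (psum f K - psum f k)).
      - replace (M * (12 * (L * exp (a k)))) with (12 * exp (a k) * (M * L)) by ring.
        apply Rmult_le_compat_l; [lra|assumption].
      - rewrite !Rmult_assoc, <- !exp_plus. do 2 f_equal. ring. }
    destruct (Rle_lt_dec (c' * b k) (a k)) as [Hun|Hsel].
    + rewrite Rmax_left by assumption.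
      destruct (exists_nat_between (L * exp (a k)) ltac:(lra)) as (n & Hn & Hn1 & Hn2).
      apply covered_weaken with (M * INR n) (exp (- a k)); [nra|lra|].
      apply covered_split with L; auto. nra.
    + rewrite Rmax_right by lra.
      assert (Hlk : exp (- c * b k) <= exp (- a k)) by (apply exp_le; pose proof (lden2_mul_le c' c k ltac:(lra)); lra).
      assert (Hlk2 : exp (- c * b k) <= exp (- (c' * b k))).
      { apply exp_le. pose proof (lden2_mul_le c' c k ltac:(lra)). lra. }
      apply covered_weaken with (M * (10 * (L * exp (a k)) + 1)) (2 * (2 * exp (- c * b k))); [nra|lra|].
      apply covered_subset with (fun y => well_approx_from tau c K y /\ near_orbit k (2 * exp (- c * b k)) y).
      { intros y Hy. split; [assumption|]. apply Hy. assumption. }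
      apply covered_near_orbit with L; [nra| |assumption|assumption].
      replace (10 * (L * exp (a k)) * exp (- a k)) with (10 * L) by (transitivity (10 * L * (exp (a k) * exp (- a k))); [rewrite Hea|]; ring).
      lra.
Qed.

(** * Covers above the exponent 1 *)

Lemma mu_hi_ge_lden c k : 1 / 2 <= c < 1 -> a k <= mu_hi c k.
Proof. intro Hc. eapply Rle_trans; [apply (lden_le_lden2 c); lra|apply Rmax_r]. Qed.

Lemma mu_hi_unbounded c B : 1 / 2 <= c < 1 -> exists K, forall k, (K <= k)%nat -> B <= mu_hi c k.
Proof.
  intro Hc. destruct (lden_unbounded B) as [K HK]. exists K. intros k Hk.
  eapply Rle_trans; [apply HK, Hk|apply mu_hi_ge_lden; assumption].
Qed.

Lemma tau_ge_2c tau c : 1 / 2 <= c < 1 -> c * (1 + tau) = tau -> 2 * c <= tau.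
Proof. intros Hc Htau. assert (tau * (1 - c) = c) by lra. nra. Qed.

(* Above the exponent 1, each ball of level [k] meets only one cluster of level [k]. *)
Lemma cover_hi_cluster tau c : 1 / 2 < c < 1 -> c * (1 + tau) = tau ->
  exists K0, forall K k M, (K0 <= K)%nat -> (K <= k)%nat ->
  covered (well_approx_from tau c K) M (2 * exp (- tau * a k)) ->
  covered (well_approx_from tau c K) M (4 * exp (- c * b k)).
Proof.
  intros Hc Htau. pose proof (tau_ge_2c tau c ltac:(lra) Htau) as Ht2.
  destruct (lden_unbounded ((ln 12 + 1) / (2 * c - 1))) as [K0 HK0].
  exists K0. intros K k M HK Hk Hcov.
  assert (H12 : ln 12 + 1 <= (2 * c - 1) * a k).
  { specialize (HK0 k ltac:(lia)). apply Rmult_le_compat_l with (r := 2 * c - 1) in HK0; [|lra].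
    replace ((2 * c - 1) * ((ln 12 + 1) / (2 * c - 1))) with (ln 12 + 1) in HK0 by (field; lra). assumption. }
  pose proof (lden_ge0 k). pose proof (lden_S k).
  (* Ball and cluster are both at most of order exp (- 2 c a_k), which is far below the spacing 1 /
     q_k since 2 c > 1. The 12 below is 2 (2 + 4), from the ball of length 2 and the cluster of
     diameter 4 in this unit. *)
  assert (E1 : exp (- tau * a k) <= exp (- 2 * c * a k)) by (apply exp_le; nra).
  assert (E2 : exp (- c * b k) <= exp (- 2 * c * a k)).
  { apply exp_le. unfold lden2. nra. }
  assert (E3 : 12 * exp (- 2 * c * a k) < exp (- a k)).
  { rewrite <- (exp_ln 12) at 1 by lra. rewrite <- exp_plus. apply exp_increasing. lra. }
  apply covered_weaken with M (2 * (2 * exp (- c * b k))); [lra|lra|].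
  apply covered_subset with (fun y => well_approx_from tau c K y /\ near_orbit k (2 * exp (- c * b k)) y).
  { intros y Hy. split; [assumption|]. apply Hy. assumption. }
  apply covered_near_orbit_single with (2 * exp (- tau * a k)); [lra|assumption].
Qed.

(** A step shrinks each ball of level k to its one cluster and then counts the points of level k + 1
    in that cluster, about q_{k+1} exp (- c b_k) of them. The covering length is reset to 2
    q_{k+1}^(-tau), so only the count accumulates. *)
Lemma cover_hi tau c c' : 1 / 2 < c' < c -> c < 1 -> c * (1 + tau) = tau ->
  exists K0, forall K, (K0 <= K)%nat -> exists C, 0 < C /\ forall k, (K <= k)%nat ->
  covered (well_approx_from tau c K) (C * exp (V_hi c' k)) (2 * exp (- tau * a k)).
Proof.
  intros Hc Hc1 Htau. pose proof (tau_ge_2c tau c ltac:(lra) Htau) as Ht2.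
  destruct (cover_hi_cluster tau c ltac:(lra) Htau) as [K1 HK1].
  destruct (lden2_unbounded (c - c') (ln 24) ltac:(lra)) as [K2 HK2].
  exists (max K1 K2). intros K HK.
  pose proof (exp_pos (- tau * a K)) as Hp.
  destruct (exists_nat_between (/ (2 * exp (- tau * a K)))) as (n & Hn & Hn1 & Hn2).
  { left. apply Rinv_0_lt_compat. lra. }
  assert (Hn0 : 0 < INR n) by (apply lt_0_INR; lia).
  exists (INR n * exp (- V_hi c' K)). split; [apply Rmult_lt_0_compat; [assumption|apply exp_pos]|].
  intros k Hk. induction Hk as [|k Hk IH].
  - rewrite Rmult_assoc, <- exp_plus, Rplus_opp_l, exp_0, Rmult_1_r.
    apply covered_weaken with (1 * INR n) (2 * exp (- tau * a K)); [lra|lra|].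
    apply covered_subset with in_torus; [intros y Hy; apply Hy|].
    apply covered_split with 1; [|lra|assumption|apply torus_covered].
    apply Rmult_lt_compat_r with (r := 2 * exp (- tau * a K)) in Hn1; [|lra].
    rewrite Rinv_l in Hn1; lra.
  - set (C := INR n * exp (- V_hi c' K)) in *.
    assert (HC : 0 < C) by (apply Rmult_lt_0_compat; [assumption|apply exp_pos]).
    apply (HK1 K k _ ltac:(lia) Hk) in IH. specialize (HK2 k ltac:(lia)).
    change (V_hi c' (S k)) with (V_hi c' k + Rmax 0 (a (S k) - c' * b k)).
    rewrite exp_plus, <- Rmult_assoc. set (M := C * exp (V_hi c' k)) in *.
    assert (HM : 0 < M) by (apply Rmult_lt_0_compat; [assumption|apply exp_pos]).
    apply covered_subset with (fun y => well_approx_from tau c K y /\ near_orbit (S k) (exp (- tau * a (S k))) y).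
    { intros y Hy. split; [assumption|]. apply Hy. lia. }
    assert (E1 : exp (- tau * a (S k)) <= exp (- c * b k)).
    { apply exp_le. pose proof (lden_S k). pose proof (lden_ge0 (S k)). unfold lden2. nra. }
    assert (Ea : exp (- c * b k) = exp (a (S k) - c * b k) * exp (- a (S k))).
    { rewrite <- exp_plus. f_equal. ring. }
    pose proof (exp_pos (- a (S k))). pose proof (exp_pos (a (S k) - c * b k)) as Hx.
    set (x := exp (a (S k) - c * b k)) in *.
    (* If 12 x < 1 the cluster meets at most one ball and the count stays exact, which keeps
       constants from accumulating. Otherwise 12 x + 1 <= 24 x, and the slack c - c' pays for 24. *)
    destruct (Rlt_le_dec (12 * x) 1) as [Hlt|Hge].
    + apply covered_weaken with M (2 * exp (- tau * a (S k))); [|lra|].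
      * rewrite <- (Rmult_1_r M) at 1. apply Rmult_le_compat_l; [lra|].
        rewrite <- exp_0. apply exp_le. apply Rmax_l.
      * apply covered_near_orbit_single with (4 * exp (- c * b k)); [nra|assumption].
    + apply covered_weaken with (M * (12 * x + 1)) (2 * exp (- tau * a (S k))); [|lra|].
      * apply Rmult_le_compat_l; [lra|]. apply Rle_trans with (24 * x); [lra|].
        apply Rle_trans with (exp (a (S k) - c' * b k)); [|apply exp_le, Rmax_r].
        unfold x. rewrite <- (exp_ln 24), <- exp_plus by lra. apply exp_le. lra.
      * apply covered_near_orbit with (4 * exp (- c * b k)); [lra|nra|lra|assumption].
Qed.

(** The same number of intervals covers before and after the shrinking to clusters of level k; the
    maximum in [mu_hi] selects the shorter length. *)
Lemma U_null_hi tau c c' s s' : 1 / 2 < c' < c -> c < 1 -> c * (1 + tau) = tau -> 0 <= s < s' ->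
  (forall K, exists k, (K <= k)%nat /\ V_hi c' k <= s * mu_hi c' k) ->
  hausdorff_null s' (U_set tau theta).
Proof.
  intros Hc Hc1 Htau Hs Hfr. apply (U_null_of_levels tau c); [lra|assumption|].
  destruct (cover_hi_cluster tau c ltac:(lra) Htau) as [K1 HK1].
  destruct (cover_hi tau c c' Hc Hc1 Htau) as [K2 HK2].
  exists (max K1 K2). intros K HK. destruct (HK2 K ltac:(lia)) as (C & HC & Hcov).
  apply null_of_frequent_covers with (V_hi c') (mu_hi c') s C; auto.
  - intro B. apply mu_hi_unbounded. lra.
  - exists K. intros k Hk. specialize (Hcov k Hk). unfold mu_hi.
    assert (Ht : c' / (1 - c') <= tau).
    { apply Rmult_le_reg_r with (1 - c'); [lra|]. unfold Rdiv. rewrite Rmult_assoc, Rinv_l by lra. nra. }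
    destruct (Rle_lt_dec (c' * b k) (c' / (1 - c') * a k)) as [Hm|Hm].
    + rewrite Rmax_left by assumption. revert Hcov. apply covered_weaken; [lra|].
      pose proof (lden_ge0 k).
      assert (exp (- tau * a k) <= exp (- (c' / (1 - c') * a k))) by (apply exp_le; nra).
      pose proof (exp_pos (- tau * a k)). lra.
    + rewrite Rmax_right by lra. apply (HK1 K k _ ltac:(lia) Hk) in Hcov.
      revert Hcov. apply covered_weaken; [lra|].
      assert (exp (- c * b k) <= exp (- (c' * b k))); [|lra].
      apply exp_le. pose proof (lden2_mul_le c' c k ltac:(lra)). lra.
Qed.

End Logs.

(** * A lower bound for Cantor sets *)

Lemma psum_le f g n : (forall i, (i < n)%nat -> f i <= g i) -> psum f n <= psum g n.
Proof.
  induction n; intro H; simpl; [lra|].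
  pose proof (H n ltac:(lia)). specialize (IHn ltac:(auto)). lra.
Qed.

Lemma psum_lt f g n : (1 <= n)%nat -> (forall i, (i < n)%nat -> f i < g i) -> psum f n < psum g n.
Proof.
  intros Hn H. destruct n; [lia|]. simpl.
  pose proof (H n ltac:(lia)). pose proof (psum_le f g n ltac:(intros; left; auto)). lra.
Qed.

Lemma psum_const c n : psum (fun _ => c) n = INR n * c.
Proof. induction n; [simpl; ring|]. cbn [psum]. rewrite IHn, S_INR. ring. Qed.

Lemma psum_scal c f n : psum (fun i => c * f i) n = c * psum f n.
Proof. induction n; simpl; [ring|]. rewrite IHn. ring. Qed.

Lemma psum_ext f g n : (forall i, (i < n)%nat -> f i = g i) -> psum f n = psum g n.
Proof. induction n; intro H; simpl; [reflexivity|]. rewrite IHn, H; auto. Qed.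

Lemma psum_sum_exchange (f : nat -> nat -> R) n m :
  psum (fun j => sum_f_R0 (f j) m) n = sum_f_R0 (fun i => psum (fun j => f j i) n) m.
Proof.
  induction n; cbn [psum].
  - induction m; simpl; [reflexivity|]. rewrite <- IHm. ring.
  - rewrite IHn. symmetry. apply (plus_sum (fun i => psum (fun j => f j i) n) (f n)).
Qed.

Fixpoint pprod (n : nat -> nat) (k : nat) : R :=
  match k with O => 1 | S k => pprod n k * INR (n k) end.

Lemma pprod_pos n k : (forall j, (1 <= n j)%nat) -> 0 < pprod n k.
Proof.
  intro Hn. induction k; simpl; [lra|]. apply Rmult_lt_0_compat; [assumption|]. apply lt_0_INR. specialize (Hn k). lia.
Qed.

Definition ind (P : Prop) : R := if excluded_middle_informative P then 1 else 0.

Lemma ind_true (P : Prop) : P -> ind P = 1.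
Proof. intro H. unfold ind. destruct excluded_middle_informative; tauto. Qed.

Lemma ind_false (P : Prop) : ~ P -> ind P = 0.
Proof. intro H. unfold ind. destruct excluded_middle_informative; tauto. Qed.

Lemma ind_bounds P : 0 <= ind P <= 1.
Proof. unfold ind. destruct excluded_middle_informative; lra. Qed.

(** Only the first and last indices satisfying P matter. It bounds the number of children of a node
    that one covering interval meets. *)
Lemma count_le_spread (P : nat -> Prop) n r :
  (forall i j, (i <= j < n)%nat -> P i -> P j -> INR (j - i) <= r) -> 0 <= r ->
  psum (fun i => ind (P i)) n <= r + 1.
Proof.
  intros H Hr.
  assert (psum (fun i => ind (P i)) n = 0 \/ exists i j, (i <= j < n)%nat /\ P i /\ P j /\
     psum (fun i => ind (P i)) n <= INR (j - i) + 1) as [->|(i & j & Hij & Hi & Hj & Hle)].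
  2: lra.
  - clear H. induction n as [|n IH]; [left; reflexivity|]. cbn [psum].
    destruct (classic (P n)) as [Hn|Hn].
    + right. rewrite ind_true by assumption. destruct IH as [->|(i & j & Hij & Hi & Hj & Hle)].
      * exists n, n. rewrite Nat.sub_diag. simpl. repeat split; auto; lra.
      * exists i, n. repeat split; auto; try lia.
        assert (INR (j - i) + 1 <= INR (n - i)); [|lra].
        rewrite <- S_INR. apply le_INR. lia.
    + rewrite ind_false, Rplus_0_r by assumption. destruct IH as [->|(i & j & Hij & Hi & Hj & Hle)]; [left; reflexivity|].
      right. exists i, j. repeat split; auto; lia.
  - specialize (H i j Hij Hi Hj). lra.
Qed.

Lemma psum_ind_le P n : psum (fun i => ind (P i)) n <= INR n.
Proof.
  eapply Rle_trans; [apply psum_le; intros; apply ind_bounds|]. rewrite psum_const. lra.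
Qed.

(** If each of the n sequences exceeded h somewhere, monotonicity would give one index at which all
    exceed it, against the average. This chooses a child once and for all partial sums of the
    weights. *)
Lemma exists_below_average (F : nat -> nat -> R) n h : (1 <= n)%nat ->
  (forall i m, F i m <= F i (S m)) ->
  (forall m, psum (fun i => F i m) n <= INR n * h) ->
  exists i, (i < n)%nat /\ forall m, F i m <= h.
Proof.
  intros Hn Hmono Havg. apply NNPP. intro Hno.
  assert (Hmono' : forall i m m', (m <= m')%nat -> F i m <= F i m').
  { intros i m m'. induction 1; [lra|]. eapply Rle_trans; [eassumption|apply Hmono]. }
  assert (exists m, forall i, (i < n)%nat -> h < F i m) as [m Hm].
  { assert (forall n', (n' <= n)%nat -> exists m, forall i, (i < n')%nat -> h < F i m) as Hx; [|apply (Hx n); lia].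
    induction n' as [|n' IH]; intro Hle; [exists 0%nat; intros; lia|].
    destruct (IH ltac:(lia)) as [m1 H1].
    assert (exists m2, h < F n' m2) as [m2 H2].
    { apply NNPP. intro Hc. apply Hno. exists n'. split; [lia|]. intro m. apply Rnot_lt_le. intro. apply Hc. eauto. }
    exists (max m1 m2). intros i Hi. destruct (Nat.eq_dec i n') as [->|].
    - eapply Rlt_le_trans; [apply H2|]. apply Hmono'. lia.
    - eapply Rlt_le_trans; [apply (H1 i); lia|]. apply Hmono'. lia. }
  specialize (Havg m). pose proof (psum_lt _ _ n Hn Hm) as Hlt. rewrite psum_const in Hlt. lra.
Qed.

Lemma sum_term_le f i : (forall j, 0 <= f j) -> f i <= sum_f_R0 f i.
Proof.
  intro H. destruct i; simpl; [lra|].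
  pose proof (cond_pos_sum f i H). lra.
Qed.

Lemma le_Rpower s x : 0 < s <= 1 -> 0 < x <= 1 -> x <= Rpower x s.
Proof. intros Hs Hx. rewrite <- (Rpower_1 x) at 1 by lra. apply Rpower_antimono_base_le1; lra. Qed.

(* Let [N k] be the product of the branching numbers.  An interval of length [r] gets, at a node of
   level [k], the weight 1 when [r >= L k] and [C r^s N k] otherwise; by the hypotheses the total
   weight of the intervals meeting a node does not increase on average over its children, so one can
   descend to a point of the limit set whose nodes all have weight at most 1/2, and such a point is
   not covered. *)
Lemma cantor_tree_not_null (T : Type) (pos : nat -> T -> R) (Node : nat -> T -> Prop)
  (Child : nat -> T -> T -> Prop) (L sigma W : nat -> R) (n : nat -> nat) (E : R -> Prop) s c :
  0 < s <= 1 -> 0 < c <= 1 ->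
  (forall k, 0 < L k) -> (forall k, L (S k) <= L k) ->
  (forall eta, 0 < eta -> exists k, L k < eta) ->
  (forall k, (1 <= n k)%nat) -> (forall k, L (S k) <= sigma k) ->
  (forall k, c <= pprod n k * Rpower (L k) s) ->
  (forall k, n k = 1%nat \/
     0 < W k /\ c * W k <= INR (n k) * sigma k /\ c <= pprod n k * Rpower (W k) s) ->
  (exists t, Node 0%nat t) ->
  (forall k t, Node k t -> exists ch : nat -> T,
     (forall i, (i < n k)%nat -> Node (S k) (ch i) /\ Child k t (ch i) /\
        pos k t <= pos (S k) (ch i) /\ pos (S k) (ch i) + L (S k) <= pos k t + L k) /\
     (forall i j, (i < j < n k)%nat ->
        pos (S k) (ch i) + L (S k) + INR (j - i) * sigma k <= pos (S k) (ch j))) ->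
  (forall (t : nat -> T) y, Node 0%nat (t 0%nat) -> (forall k, Node k (t k) /\ Child k (t k) (t (S k))) ->
     (forall k, pos k (t k) <= y <= pos k (t k) + L k) -> E y) ->
  ~ hausdorff_null s E.
Proof.
  intros Hs Hc HL HLdec HL0 Hn Hsig HNL HW [t0 Ht0] Hch HE Hnull.
  set (N := pprod n). assert (HN : forall k, 0 < N k) by (intro; apply pprod_pos, Hn).
  set (C := 2 / (c * c)).
  assert (Hcc : 0 < c * c) by nra.
  assert (HC0 : 0 < C) by (apply Rdiv_lt_0_compat; lra).
  assert (HCc2 : C * c * c = 2) by (unfold C; field; lra).
  assert (HCc : 2 <= C * c) by nra.
  assert (HC1 : 1 <= C) by nra.
  (* No interval of this cover reaches length L_0, so at the root all weights are C r^s, with sum at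
     most C / (2 C) = 1/2. *)
  destruct (Hnull (L 0%nat / 2) (/ (2 * C))) as (A & B & HAB & Hcov & Hsum).
  { specialize (HL 0%nat). lra. }
  { apply Rinv_0_lt_compat. lra. }
  set (r := fun i => B i - A i).
  assert (Hr : forall i, 0 < r i) by (intro i; unfold r; destruct (HAB i); lra).
  set (meets := fun k t i => A i <= pos k t + L k /\ pos k t <= B i).
  set (wt := fun k i => if Rle_dec (L k) (r i) then 1 else C * Rpower (r i) s * N k).
  assert (Hwt : forall k i, 0 <= wt k i).
  { intros k i. unfold wt. destruct Rle_dec; [lra|]. pose proof (Rpower_pos (r i) s). specialize (HN k).
    apply Rmult_le_pos; [apply Rmult_le_pos; lra|lra]. }
  set (term := fun k t i => ind (meets k t i) * wt k i).
  assert (Hterm : forall k t i, 0 <= term k t i).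
  { intros k t i. apply Rmult_le_pos; [apply ind_bounds|apply Hwt]. }
  set (good := fun k t => Node k t /\ forall m, sum_f_R0 (term k t) m <= 1 / 2).
  assert (Hgood0 : good 0%nat t0).
  { split; [assumption|]. intro m.
    apply Rle_trans with (sum_f_R0 (fun i => Rpower (r i) s * C) m).
    - apply sum_Rle. intros i _. unfold term, wt. destruct Rle_dec as [Hle|_].
      + exfalso. destruct (HAB i). fold (r i) in *. specialize (HL 0%nat). lra.
      + pose proof (ind_bounds (meets 0%nat t0 i)). pose proof (Rpower_pos (r i) s).
        unfold N; simpl. rewrite Rmult_1_r. assert (0 < Rpower (r i) s * C) by nra. nra.
    - rewrite <- scal_sum. specialize (Hsum m). fold r in Hsum.
      apply Rmult_le_compat_l with (r := C) in Hsum; [|lra].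
      replace (C * / (2 * C)) with (1 / 2) in Hsum by (field; lra). exact Hsum. }
  assert (Hstep : forall k t, good k t -> exists t', good (S k) t' /\ Child k t t' /\
     pos k t <= pos (S k) t' /\ pos (S k) t' + L (S k) <= pos k t + L k).
  { intros k t [Hnode Hsm]. destruct (Hch k t Hnode) as (ch & Hch1 & Hch2).
    destruct (exists_below_average (fun j m => sum_f_R0 (term (S k) (ch j)) m) (n k) (1 / 2)) as (j & Hj & Hjm).
    - apply Hn.
    - intros i m. simpl. specialize (Hterm (S k) (ch i) (S m)). lra.
    (* Interval by interval: the weights of interval i over all children must sum to at most n_k
       times its weight at the parent. *)
    - intro m. rewrite psum_sum_exchange.
      apply Rle_trans with (sum_f_R0 (fun i => term k t i * INR (n k)) m).
      2:{ rewrite <- scal_sum. apply Rmult_le_compat_l; [apply pos_INR|apply Hsm]. }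
      apply sum_Rle. intros i _.
      rewrite (psum_ext _ (fun j => wt (S k) i * ind (meets (S k) (ch j) i))) by (intros; apply Rmult_comm).
      rewrite psum_scal. unfold term.
      destruct (classic (meets k t i)) as [Hm|Hm].
      2:{ rewrite (psum_ext _ (fun _ => 0)).
          - rewrite psum_const, ind_false by assumption. lra.
          - intros j Hj. apply ind_false. intros [H1 H2]. apply Hm.
            destruct (Hch1 j Hj) as (_ & _ & H3 & H4). split; lra. }
      rewrite ind_true, Rmult_1_l by assumption.
      set (cnt := psum _ _).
      assert (Hcn : cnt <= INR (n k)) by apply psum_ind_le.
      assert (Hcnt : 0 < sigma k -> cnt <= r i / sigma k + 1).
      { intro Hsp. apply count_le_spread.
        - intros i1 j1 Hij [H1 H2] [H3 H4]. destruct (Nat.eq_dec i1 j1) as [->|Hne].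
          + rewrite Nat.sub_diag. simpl. apply Rmult_le_pos; [left; apply Hr|left; apply Rinv_0_lt_compat; assumption].
          + specialize (Hch2 i1 j1 ltac:(lia)). apply Rmult_le_reg_r with (sigma k); [assumption|].
            unfold Rdiv. rewrite Rmult_assoc, Rinv_l by lra. unfold r. lra.
        - apply Rmult_le_pos; [left; apply Hr|left; apply Rinv_0_lt_compat; assumption]. }
      assert (Hsp : 0 < sigma k) by (specialize (Hsig k); specialize (HL (S k)); lra). specialize (Hcnt Hsp).
      (* The spread bound gives only cnt < 2; integrality of the count sharpens it. *)
      assert (Hcnt1 : r i < sigma k -> cnt <= 1).
      { intro Hlt. assert (forall P m, exists z : nat, psum (fun i => ind (P i)) m = INR z) as Hnat.
        { intros P m0. induction m0 as [|m0 [z Hz]]; [exists 0%nat; reflexivity|]. cbn [psum]. rewrite Hz.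
          unfold ind. destruct excluded_middle_informative; [exists (S z); rewrite S_INR; ring|exists z; ring]. }
        destruct (Hnat (fun j => meets (S k) (ch j) i) (n k)) as [z Hz]. fold cnt in Hz. rewrite Hz in *.
        assert (r i / sigma k < 1).
        { apply Rmult_lt_reg_r with (sigma k); [assumption|]. unfold Rdiv. rewrite Rmult_assoc, Rinv_l by lra. lra. }
        assert (INR z < INR 2) as Hz2 by (simpl; lra). apply INR_lt in Hz2.
        change 1 with (INR 1). apply le_INR. lia. }
      assert (Hcnt0 : 0 <= cnt).
      { apply Rle_trans with (psum (fun _ => 0) (n k)); [rewrite psum_const; lra|].
        apply psum_le. intros; apply ind_bounds. }
      assert (Hn1 : 1 <= INR (n k)) by (change 1 with (INR 1); apply le_INR, Hn).
      pose proof (HN k) as HNk. specialize (Hr i).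
      pose proof (Rpower_pos (r i) s) as Hrs.
      unfold wt. destruct (Rle_dec (L (S k)) (r i)) as [Hbig|Hsmall].
      (* For L_{k+1} <= r < L_k each child met weighs 1 while the parent weighs C r^s N_k, so the
         claim is cnt <= C r^s N_k n_k. [Hone] settles the case of one child. *)
      + rewrite Rmult_1_l. destruct (Rle_dec (L k) (r i)) as [Hbig2|Hsmall2]; [lra|].
        assert (Hone : 1 <= C * Rpower (r i) s * N k * INR (n k)).
        { specialize (HNL (S k)). cbn [pprod] in HNL. fold (N k) in HNL.
          assert (Rpower (L (S k)) s <= Rpower (r i) s) by (apply Rle_Rpower_l; [lra|]; split; [apply HL|lra]).
          pose proof (Rpower_pos (L (S k)) s).
          assert (c <= N k * INR (n k) * Rpower (r i) s) by (assert (0 < N k * INR (n k)) by nra; nra).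
          nra. }
        destruct (HW k) as [Hn'|(HWp & HWs & HWN)].
        * rewrite Hn' in *. simpl INR in *. lra.
        * destruct (Rlt_le_dec (r i) (sigma k)) as [Hrs1|Hrs1]; [specialize (Hcnt1 Hrs1); lra|].
          (* For r >= W the parent weighs at least 1. For r < W, use cnt <= 2 r / sigma and (r /
             W)^s >= r / W; the two hypotheses on W each cost a factor c, which is why C = 2 /
             c^2. *)
          fold (N k) in HWN. destruct (Rle_lt_dec (W k) (r i)) as [HrW|HrW].
          -- assert (Rpower (W k) s <= Rpower (r i) s) by (apply Rle_Rpower_l; lra).
             assert (c <= N k * Rpower (r i) s) by nra.
             assert (1 <= C * Rpower (r i) s * N k) by nra. nra.
          -- assert (Hrat : 0 < r i / W k <= 1).
             { split; [apply Rdiv_lt_0_compat; assumption|]. apply Rmult_le_reg_r with (W k); [assumption|].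
               unfold Rdiv. rewrite Rmult_assoc, Rinv_l by lra. lra. }
             pose proof (le_Rpower s (r i / W k) Hs Hrat) as Hp.
             assert (Epow : Rpower (r i) s = Rpower (r i / W k) s * Rpower (W k) s).
             { rewrite Rpower_mult_distr; [|lra|assumption]. f_equal. field. lra. }
             assert (H1 : c * (r i / W k) <= N k * Rpower (r i) s).
             { rewrite Epow. pose proof (Rpower_pos (W k) s).
               apply Rle_trans with (N k * Rpower (W k) s * (r i / W k)); [nra|].
               replace (N k * (Rpower (r i / W k) s * Rpower (W k) s)) with (N k * Rpower (W k) s * Rpower (r i / W k) s) by ring.
               apply Rmult_le_compat_l; [nra|assumption]. }
             assert (H2 : r i / sigma k * c <= INR (n k) * (r i / W k)).
             { apply Rmult_le_reg_r with (sigma k * W k); [nra|].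
               replace (r i / sigma k * c * (sigma k * W k)) with (r i * (c * W k)) by (field; lra).
               replace (INR (n k) * (r i / W k) * (sigma k * W k)) with (r i * (INR (n k) * sigma k)) by (field; lra).
               apply Rmult_le_compat_l; lra. }
             assert (H3 : 1 <= r i / sigma k).
             { apply Rmult_le_reg_r with (sigma k); [assumption|]. unfold Rdiv. rewrite Rmult_assoc, Rinv_l by lra. lra. }
             apply Rle_trans with (2 * (r i / sigma k)); [lra|].
             rewrite <- HCc2.
             apply Rle_trans with (C * c * (INR (n k) * (r i / W k))).
             ++ replace (C * c * c * (r i / sigma k)) with (C * c * (r i / sigma k * c)) by ring.
                apply Rmult_le_compat_l; [nra|assumption].
             ++ replace (C * c * (INR (n k) * (r i / W k))) with (C * INR (n k) * (c * (r i / W k))) by ring.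
                replace (C * Rpower (r i) s * N k * INR (n k)) with (C * INR (n k) * (N k * Rpower (r i) s)) by ring.
                apply Rmult_le_compat_l; [nra|assumption].
      (* An interval shorter than a child meets at most one child, whose weight is exactly n_k times
         that of the parent. *)
      + assert (cnt <= 1) as H1 by (apply Hcnt1; specialize (Hsig k); lra).
        destruct (Rle_dec (L k) (r i)) as [Hbig2|Hsmall2]; [specialize (HLdec k); lra|].
        change (N (S k)) with (N k * INR (n k)).
        assert (0 < C * Rpower (r i) s * (N k * INR (n k))).
        { apply Rmult_lt_0_compat; [|apply Rmult_lt_0_compat; lra]. apply Rmult_lt_0_compat; lra. }
        nra.
    - exists (ch j). destruct (Hch1 j Hj) as (H1 & H2 & H3 & H4). repeat split; auto. }
  set (next := fun k (x : {t | good k t}) =>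
     let e := constructive_indefinite_description _ (Hstep k (proj1_sig x) (proj2_sig x)) in
     exist (good (S k)) (proj1_sig e) (proj1 (proj2_sig e))).
  set (path := nat_rect (fun k => {t | good k t}) (exist _ t0 Hgood0) next).
  set (t := fun k => proj1_sig (path k)).
  assert (Hpath : forall k, good k (t k) /\ Child k (t k) (t (S k)) /\
     pos k (t k) <= pos (S k) (t (S k)) /\ pos (S k) (t (S k)) + L (S k) <= pos k (t k) + L k).
  { intro k. split; [apply (proj2_sig (path k))|]. unfold t. simpl.
    destruct (constructive_indefinite_description _ (Hstep k (proj1_sig (path k)) (proj2_sig (path k)))) as [t' Ht'].
    simpl. tauto. }
  assert (Hup : forall j k, (j <= k)%nat -> pos j (t j) <= pos k (t k) /\ pos k (t k) + L k <= pos j (t j) + L j).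
  { intros j k. induction 1; [lra|]. destruct (Hpath m) as (_ & _ & ? & ?). lra. }
  destruct (completeness (fun x => exists k, x = pos k (t k))) as [y [Hy1 Hy2]].
  { exists (pos 0%nat (t 0%nat) + L 0%nat). intros x [k ->]. destruct (Hup 0%nat k ltac:(lia)). specialize (HL k). lra. }
  { exists (pos 0%nat (t 0%nat)), 0%nat. reflexivity. }
  assert (Hy : forall k, pos k (t k) <= y <= pos k (t k) + L k).
  { intro k. split; [apply Hy1; eauto|]. apply Hy2. intros x [j ->].
    destruct (Nat.le_ge_cases j k) as [H|H]; destruct (Hup _ _ H).
    - specialize (HL k). lra.
    - specialize (HL j). lra. }
  destruct (Hcov y) as [i Hi].
  { apply (HE t); [apply Hpath|intro k; split; apply Hpath|assumption]. }
  (* The interval containing y meets every node of the path; once L_k < r_i it has weight 1 there,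
     against the bound 1/2. *)
  destruct (HL0 (r i) (Hr i)) as [k Hk].
  destruct (Hpath k) as [[_ Hg] _]. specialize (Hg i). specialize (Hy k).
  pose proof (sum_term_le (term k (t k)) i (Hterm k (t k))) as Hle.
  assert (term k (t k) i = 1) as E1.
  { unfold term, wt. rewrite ind_true; [|split; lra]. destruct Rle_dec; lra. }
  lra.
Qed.

(** * Lower bound above the exponent 1 *)

(** A branching number must be at least 1; this rounding keeps that and still loses at most a factor
    2 from below. *)
Definition floor1 (x : R) : nat := Nat.max 1 (Z.to_nat (Int_part x)).

Lemma floor1_ge1 x : (1 <= floor1 x)%nat.
Proof. apply Nat.le_max_l. Qed.

Lemma floor1_spec x : 0 <= x ->
  (floor1 x = 1%nat \/ 1 <= x /\ INR (floor1 x) <= x) /\ x / 2 <= INR (floor1 x).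
Proof.
  intro Hx. destruct (base_Int_part x) as [H1 H2]. unfold floor1.
  destruct (Z_le_gt_dec 1 (Int_part x)) as [H|H].
  - rewrite Nat.max_r by lia. rewrite INR_IZR_INZ, Z2Nat.id by lia. apply IZR_le in H.
    split; [right|]; lra.
  - rewrite Nat.max_l by lia. split; [left; reflexivity|].
    assert (Int_part x <= 0)%Z as H' by lia. apply IZR_le in H'. simpl. lra.
Qed.

Section LowerBounds.
Variables (theta : R) (cf : convergents theta).
Local Notation q := (den cf).
Local Notation p := (numer cf).
Local Notation D := (err cf).
Local Notation sg := (sgn cf).
Local Notation a := (lden theta cf).
Local Notation b := (lden2 theta cf).

Lemma exists_level K Q : exp (a K) <= Q ->
  exists k, (K <= k)%nat /\ a k <= ln Q < a (S k).
Proof.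
  intro HQ. assert (HQ0 : 0 < Q) by (pose proof (exp_pos (a K)); lra).
  assert (HK : a K <= ln Q) by (rewrite <- (ln_exp (a K)); apply ln_le; [apply exp_pos|assumption]).
  destruct (lden_unbounded theta cf (ln Q + 1)) as [K' HK'].
  specialize (HK' (K + K')%nat ltac:(lia)).
  assert (Hlt : ln Q < a (K + K')%nat) by lra. clear HK'.
  induction K' as [|K' IH].
  - rewrite Nat.add_0_r in Hlt. lra.
  - destruct (Rlt_le_dec (ln Q) (a (K + K')%nat)) as [H|H]; [auto|].
    exists (K + K')%nat. rewrite Nat.add_succ_r in Hlt. split; [lia|lra].
Qed.

Lemma pprod_ge_exp_V_hi n c K :
  (forall j, (K <= j)%nat -> exp (Rmax 0 (a (S j) - c * b j)) <= INR (n j)) ->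
  forall k, exp (V_hi theta cf c (K + k) - V_hi theta cf c K) <= pprod (fun j => n (K + j)%nat) k.
Proof.
  intros H k. induction k as [|k IH].
  - rewrite Nat.add_0_r, Rminus_diag, exp_0. simpl. lra.
  - rewrite Nat.add_succ_r. cbn [pprod].
    change (V_hi theta cf c (S (K + k))) with (V_hi theta cf c (K + k) + Rmax 0 (a (S (K + k)) - c * b (K + k)%nat)).
    match goal with |- exp (?u + ?v - ?w) <= _ => replace (u + v - w) with ((u - w) + v) by ring end.
    rewrite exp_plus. apply Rmult_le_compat; [left; apply exp_pos|left; apply exp_pos|assumption|].
    apply H. lia.
Qed.

Section Hi.
Variables (tau c c' s : R) (K : nat).
Hypotheses (Hc : 1 / 2 < c < c') (Hc' : c' < 1) (Htau : c * (1 + tau) = tau) (Hs : 0 < s <= 1).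
Hypotheses (Hth : 0 < theta < 1).
Hypothesis (HV : forall k, (K <= k)%nat -> s * mu_hi theta cf c' k <= V_hi theta cf c' k).
Hypothesis (Hrho : forall k, (K <= k)%nat -> ln 8 <= (tau - 1) * a k).
Hypothesis (Hgap : forall k, (K <= k)%nat -> ln 8 <= (c' - c) * b k).
Hypothesis (Hroot : exp (- tau * a K) < theta /\ exp (- tau * a K) < 1 - theta).

(** The ideal number of children is the number of next-level points in a cluster. The factor 1/4
    makes the children, which are D_k <= 1 / q_{k+1} apart, spread over at most exp (- c b_k) /
    4. *)
Let x (k : nat) := exp (a (S k) - c * b k) / 4.
Let br (k : nat) := floor1 (x k).
Let rho (k : nat) := exp (- tau * a k).

Let Hx k : 0 < x k.
Proof. unfold x. pose proof (exp_pos (a (S k) - c * b k)). lra. Qed.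

Let Htau2 : 1 < tau.
Proof. pose proof (tau_ge_2c tau c ltac:(lra) Htau). lra. Qed.

Let Htc : tau * (1 - c) = c.
Proof. lra. Qed.

Let Hrho_pos k : 0 < rho k.
Proof. apply exp_pos. Qed.

Let Hrho8 k : (K <= k)%nat -> 8 * rho k <= exp (- a k).
Proof.
  intro Hk. unfold rho. rewrite <- (exp_ln 8), <- exp_plus by lra. apply exp_le.
  specialize (Hrho k Hk). lra.
Qed.

Let Hbr k : br k = 1%nat \/ 1 <= x k /\ INR (br k) <= x k.
Proof. apply floor1_spec. left. apply Hx. Qed.

Let Hbr_half k : x k / 2 <= INR (br k).
Proof. apply floor1_spec. left. apply Hx. Qed.

Let Hbr1 k : 1 <= INR (br k).
Proof. change 1 with (INR 1). apply le_INR, floor1_ge1. Qed.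

Let Hbr_exp k : (K <= k)%nat -> exp (Rmax 0 (a (S k) - c' * b k)) <= INR (br k).
Proof.
  intro Hk. unfold Rmax. destruct Rle_dec.
  - apply Rle_trans with (x k / 2); [|apply Hbr_half]. unfold x.
    assert (8 * exp (a (S k) - c' * b k) <= exp (a (S k) - c * b k)); [|lra].
    rewrite <- (exp_ln 8), <- exp_plus by lra. apply exp_le. specialize (Hgap k Hk). lra.
  - rewrite exp_0. apply Hbr1.
Qed.

Let Hsel k : 1 <= x k ->
  x k * exp (- a (S k)) = exp (- c * b k) / 4 /\ exp (- c * b k) <= rho k /\ 4 * rho (S k) <= exp (- c * b k).
Proof.
  intro H1. assert (H4 : ln 4 <= a (S k) - c * b k).
  { rewrite <- (ln_exp (a (S k) - c * b k)). apply ln_le; [lra|]. unfold x in H1. lra. }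
  assert (0 < ln 4) by (rewrite <- ln_1; apply ln_increasing; lra).
  pose proof (lden_ge0 theta cf (S k)).
  split; [|split].
  - unfold x. replace (exp (a (S k) - c * b k) / 4 * exp (- a (S k))) with (exp (a (S k) - c * b k) * exp (- a (S k)) / 4) by field.
    rewrite <- exp_plus. do 2 f_equal. ring.
  - apply exp_le. unfold lden2 in *. nra.
  - unfold rho. rewrite <- (exp_ln 4), <- exp_plus by lra. apply exp_le. nra.
Qed.

(** This nests the balls: every child ball lies in the ball of its parent. *)
Let Hspread k : (K <= k)%nat -> (INR (br k) - 1) * D k + rho (S k) <= rho k.
Proof.
  intro Hk. destruct (Hbr k) as [->|[H1 H2]].
  - simpl. rewrite Rminus_diag, Rmult_0_l, Rplus_0_l. apply exp_le.
    pose proof (lden_S theta cf k). nra.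
  - destruct (Hsel k H1) as (E1 & E2 & E3). pose proof (err_le_exp theta cf k). pose proof (err_pos cf k).
    assert (INR (br k) * D k <= x k * exp (- a (S k))) by (apply Rmult_le_compat; [apply pos_INR|lra|lra|lra]).
    nra.
Qed.

(** This keeps the indices n + z q_k of the children in [1, q_{k+1}]. *)
Let Hbr_den k : INR (br k) * IZR (q k) <= IZR (q (S k)).
Proof.
  destruct (Hbr k) as [->|[H1 H2]].
  - simpl. rewrite Rmult_1_l. apply IZR_le, den_le.
  - rewrite <- !exp_lden. apply Rle_trans with (x k * exp (a k)).
    + apply Rmult_le_compat_r; [left; apply exp_pos|assumption].
    + unfold x. pose proof (lden_le_lden2 theta cf c k ltac:(lra)).
      assert (exp (a (S k) - c * b k) * exp (a k) <= exp (a (S k))) by (rewrite <- exp_plus; apply exp_le; lra).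
      pose proof (exp_pos (a (S k))). lra.
Qed.

Let Child (k : nat) (t t' : Z * Z) : Prop := exists z : Z,
  (0 <= z < Z.of_nat (br k))%Z /\ fst t' = (fst t + z * q k)%Z /\ snd t' = (snd t + z * p k)%Z.

(** For q_k <= Q < q_{k+1} the index of level k + 1 approximates y to within q_{k+1}^(-tau) <
    Q^(-tau). It is admissible if it equals that of level k, or if Q >= exp ((1 - c) b_k), since it
    is at most x_k q_k. For smaller Q the index of level k works: the drift z D_k and the radius of
    level k + 1 are each at most exp (- c b_k) / 4, and exp (- c b_k) <= Q^(-tau). *)
Let in_U y (t : nat -> Z * Z) : in_torus y ->
  (forall k, (K <= k)%nat -> (1 <= fst (t k) <= q k)%Z) ->
  (forall k, (K <= k)%nat -> Child k (t k) (t (S k))) ->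
  (forall k, (K <= k)%nat -> Rabs (IZR (fst (t k)) * theta - IZR (snd (t k)) - y) <= rho k) ->
  U_set tau theta y.
Proof.
  intros Hy Ht Hch Hd. apply U_set_iff. split; [assumption|].
  exists (exp (a K)). intros Q HQ. apply Rge_le in HQ.
  destruct (exists_level K Q HQ) as (k & Hk & Hu1 & Hu2).
  assert (HQ0 : 0 < Q) by (pose proof (exp_pos (a K)); lra).
  unfold approximable, Rpower. set (u := ln Q) in *.
  assert (HQu : Q = exp u) by (symmetry; apply exp_ln, HQ0).
  assert (HkQ : IZR (q k) <= Q) by (rewrite HQu, <- exp_lden; apply exp_le; assumption).
  assert (HS : rho (S k) < exp (- tau * u)) by (apply exp_increasing; nra).
  pose proof (Ht k Hk) as [Hn1 Hn2].
  destruct (Hch k Hk) as (z & Hz & Ez1 & Ez2).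
  pose proof (Hd (S k) ltac:(lia)) as HdS.
  destruct (Z.eq_dec z 0) as [->|Hz0].
  - exists (fst (t (S k))), (snd (t (S k))). rewrite Z.mul_0_l, Z.add_0_r in Ez1.
    split; [lia|]. split; [|lra]. rewrite Ez1. apply IZR_le in Hn2. lra.
  - destruct (Hbr k) as [Hb1|[H1 H2]]; [lia|]. destruct (Hsel k H1) as (E1 & E2 & E3).
    destruct (Rle_lt_dec ((1 - c) * b k) u) as [Hbu|Hbu].
    + exists (fst (t (S k))), (snd (t (S k))). pose proof (Ht (S k) ltac:(lia)).
      split; [lia|]. split; [|lra].
      assert (IZR (fst (t (S k))) <= INR (br k) * IZR (q k)).
      { rewrite Ez1, INR_IZR_INZ, <- mult_IZR. apply IZR_le. nia. }
      apply Rle_trans with (x k * IZR (q k)).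
      { pose proof (den_IZR_ge1 theta cf k). nra. }
      rewrite HQu, <- exp_lden. apply Rle_trans with (exp ((1 - c) * b k)); [|apply exp_le; assumption].
      unfold x. replace ((1 - c) * b k) with ((a (S k) - c * b k) + a k) by (unfold lden2; ring).
      rewrite exp_plus. pose proof (exp_pos (a (S k) - c * b k)). pose proof (exp_pos (a k)). nra.
    + exists (fst (t k)), (snd (t k)). split; [lia|]. split; [apply IZR_le in Hn2; lra|].
      replace (IZR (fst (t k)) * theta - IZR (snd (t k)) - y) with
        ((IZR (fst (t (S k))) * theta - IZR (snd (t (S k))) - y) + - (IZR z * (IZR (q k) * theta - IZR (p k)))).
      2:{ rewrite Ez1, Ez2, !plus_IZR, !mult_IZR. ring. }
      eapply Rle_lt_trans; [apply Rabs_triang|].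
      rewrite Rabs_Ropp, err_eq, !Rabs_mult, abs_sgn, Rmult_1_l.
      pose proof (err_pos cf k). pose proof (err_le_exp theta cf k).
      assert (0 <= IZR z <= x k).
      { split; [apply IZR_le; lia|]. apply Rle_trans with (INR (br k)); [|assumption].
        rewrite INR_IZR_INZ. apply IZR_le. lia. }
      rewrite (Rabs_pos_eq (IZR z)), (Rabs_pos_eq (D k)) by lra.
      assert (IZR z * D k <= exp (- c * b k) / 4) by (rewrite <- E1; apply Rmult_le_compat; lra).
      assert (exp (- c * b k) <= exp (- tau * u)).
      { apply exp_le. rewrite <- Htc. nra. }
      pose proof (exp_pos (- c * b k)). lra.
Qed.

Lemma U_not_null_hi_from : ~ hausdorff_null s (U_set tau theta).
Proof.
  (* 1/32 collects the 1/4 in x, the 1/2 lost in rounding and D_k / 2 >= 1 / (4 q_{k+1}); the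
     exponential accounts for starting the product at level K. *)
  set (cst := Rmin (1 / 32) (exp (- V_hi theta cf c' K))).
  assert (Hcst : 0 < cst) by (apply Rmin_glb_lt; [lra|apply exp_pos]).
  assert (Hcst1 : cst <= 1 / 32) by apply Rmin_l.
  assert (Hcst2 : cst <= exp (- V_hi theta cf c' K)) by apply Rmin_r.
  assert (HN : forall k, exp (- V_hi theta cf c' K) * exp (s * mu_hi theta cf c' (K + k)) <= pprod (fun j => br (K + j)) k).
  { intro k. eapply Rle_trans; [|apply (pprod_ge_exp_V_hi br c' K Hbr_exp)].
    rewrite <- exp_plus. apply exp_le. specialize (HV (K + k)%nat ltac:(lia)). lra. }
  assert (Hscale : forall k l, exp (- mu_hi theta cf c' (K + k)) <= l -> cst <= pprod (fun j => br (K + j)) k * Rpower l s).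
  { intros k l Hl. apply Rle_trans with (exp (- V_hi theta cf c' K) * exp (s * mu_hi theta cf c' (K + k)) * exp (s * - mu_hi theta cf c' (K + k))).
    - rewrite Rmult_assoc, <- exp_plus.
      match goal with |- _ <= _ * exp ?z => replace z with 0 by ring end. rewrite exp_0. lra.
    - apply Rmult_le_compat; [apply Rmult_le_pos; left; apply exp_pos|left; apply exp_pos|apply HN|].
      rewrite <- Rpower_exp. apply Rle_Rpower_l; [lra|]. split; [apply exp_pos|assumption]. }
  assert (Htt : tau <= c' / (1 - c')).
  { apply Rmult_le_reg_r with (1 - c'); [lra|]. unfold Rdiv. rewrite Rmult_assoc, Rinv_l by lra. nra. }
  (* A node (n, m) is the ball of radius rho about n theta - m. Removing a ball from the spacing D_k
     leaves a gap of at least D_k / 2, and W is the cluster scale. The scale conditions at L and at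
     W are the two terms of the maximum in [mu_hi]. *)
  apply (cantor_tree_not_null (Z * Z)
    (fun k t => IZR (fst t) * theta - IZR (snd t) - rho (K + k))
    (fun k t => (1 <= fst t <= q (K + k))%Z /\ (k = 0%nat -> t = (1%Z, 0%Z)))
    (fun k => Child (K + k))
    (fun k => 2 * rho (K + k)) (fun k => D (K + k)%nat / 2) (fun k => exp (- c * b (K + k)%nat))
    (fun k => br (K + k)) (U_set tau theta) s cst).
  - assumption.
  - lra.
  - intro k. specialize (Hrho_pos (K + k)%nat). lra.
  - intro k. rewrite Nat.add_succ_r. apply Rmult_le_compat_l; [lra|]. apply exp_le.
    pose proof (lden_S theta cf (K + k)). nra.
  - intros eta Heta. destruct (lden_unbounded theta cf (- ln (eta / 4))) as [K' HK'].
    exists K'. specialize (HK' (K + K')%nat ltac:(lia)).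
    assert (rho (K + K') <= eta / 4); [|lra].
    apply exp_le_of_le_ln; [lra|]. pose proof (lden_ge0 theta cf (K + K')). nra.
  - intro k. apply floor1_ge1.
  - intro k. rewrite Nat.add_succ_r. pose proof (Hrho8 (S (K + k)) ltac:(lia)).
    pose proof (err_ge_exp theta cf (K + k)). lra.
  - intro k. apply Hscale. apply Rle_trans with (rho (K + k)); [|specialize (Hrho_pos (K + k)%nat); lra].
    apply exp_le. pose proof (Rmax_l (c' / (1 - c') * a (K + k)%nat) (c' * b (K + k)%nat)).
    unfold mu_hi. pose proof (lden_ge0 theta cf (K + k)). nra.
  - intro k. right. pose proof (exp_pos (- c * b (K + k)%nat)) as Hp. split; [assumption|]. split.
    + apply Rle_trans with (x (K + k) / 2 * (exp (- a (S (K + k))) / 2 / 2)).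
      * unfold x.
        replace (exp (a (S (K + k)) - c * b (K + k)%nat) / 4 / 2 * (exp (- a (S (K + k))) / 2 / 2))
          with (exp (a (S (K + k)) - c * b (K + k)%nat) * exp (- a (S (K + k))) / 32) by field.
        rewrite <- exp_plus.
        replace (a (S (K + k)) - c * b (K + k)%nat + - a (S (K + k))) with (- c * b (K + k)%nat) by ring. nra.
      * apply Rmult_le_compat; [specialize (Hx (K + k)%nat); lra|pose proof (exp_pos (- a (S (K + k)))); lra|apply Hbr_half|].
        pose proof (err_ge_exp theta cf (K + k)). lra.
    + apply Hscale. apply exp_le. pose proof (Rmax_r (c' / (1 - c') * a (K + k)%nat) (c' * b (K + k)%nat)).
      unfold mu_hi. pose proof (lden2_mul_le theta cf c c' (K + k) ltac:(lra)). lra.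
  - exists (1%Z, 0%Z). simpl. pose proof (den_ge1 theta cf (K + 0)). split; [lia|reflexivity].
  - intros k t [Ht _]. rewrite Nat.add_succ_r. set (k' := (K + k)%nat).
    assert (Hk' : (K <= k')%nat) by (unfold k'; lia).
    (* For negative sign the multiples of q_k move to the left, so the enumeration is reversed to
       list the children from left to right. *)
    set (mm := fun i : nat => if Rlt_dec 0 (sg k') then Z.of_nat i else (Z.of_nat (br k') - 1 - Z.of_nat i)%Z).
    assert (Hmm : forall i, (i < br k')%nat -> (0 <= mm i < Z.of_nat (br k'))%Z).
    { intros i Hi. unfold mm. destruct Rlt_dec; lia. }
    assert (Hpos : forall i, IZR (fst t + mm i * q k') * theta - IZR (snd t + mm i * p k') =
       IZR (fst t) * theta - IZR (snd t) + IZR (mm i) * (sg k' * D k')).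
    { intro i. rewrite <- err_eq, !plus_IZR, !mult_IZR. ring. }
    pose proof (err_pos cf k') as HD.
    exists (fun i => ((fst t + mm i * q k')%Z, (snd t + mm i * p k')%Z)). cbn [fst snd]. split.
    + intros i Hi. specialize (Hmm i Hi). rewrite Hpos.
      assert (Hlo : Rabs (IZR (mm i) * (sg k' * D k')) <= (INR (br k') - 1) * D k').
      { rewrite !Rabs_mult, abs_sgn, Rmult_1_l, (Rabs_pos_eq (D k')) by lra.
        apply Rmult_le_compat_r; [lra|]. rewrite Rabs_pos_eq by (apply IZR_le; lia).
        rewrite INR_IZR_INZ, <- minus_IZR. apply IZR_le. lia. }
      pose proof (Hspread k' Hk'). pose proof (Rle_abs (IZR (mm i) * (sg k' * D k'))).
      pose proof (Rle_abs (- (IZR (mm i) * (sg k' * D k')))) as Hneg. rewrite Rabs_Ropp in Hneg.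
      split; [|split; [|split; lra]].
      * split; [|intro; lia]. pose proof (den_ge1 theta cf k'). split; [nia|].
        pose proof (Hbr_den k') as Hd. rewrite INR_IZR_INZ, <- mult_IZR in Hd. apply le_IZR in Hd. fold k' in Ht. nia.
      * exists (mm i). auto.
    + intros i j Hij. rewrite !Hpos.
      assert (IZR (mm j) * (sg k' * D k') = IZR (mm i) * (sg k' * D k') + INR (j - i) * D k') as ->.
      { rewrite minus_INR by lia. unfold mm. destruct (sgn_pm1 cf k') as [->| ->];
          [destruct (Rlt_dec 0 1); [|lra] | destruct (Rlt_dec 0 (-1)); [lra|]];
          repeat rewrite minus_IZR; rewrite !INR_IZR_INZ; ring. }
      assert (1 <= INR (j - i)) by (change 1 with (INR 1); apply le_INR; lia).
      pose proof (Hrho8 (S k') ltac:(lia)). pose proof (err_ge_exp theta cf k'). nra.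
  - intros t y Ht0 Ht Hy.
    assert (Hshift : forall k, (K <= k)%nat -> (K + (k - K))%nat = k) by (intros; lia).
    apply (in_U y (fun k => t (k - K)%nat)).
    + specialize (Hy 0%nat). destruct (Ht 0%nat) as [[_ E] _]. rewrite E in Hy by reflexivity.
      cbn [fst snd] in Hy. rewrite Nat.add_0_r in Hy. unfold in_torus. fold (rho K) in Hroot. lra.
    + intros k Hk. destruct (Ht (k - K)%nat) as [[H _] _]. rewrite Hshift in H by assumption. assumption.
    + intros k Hk. destruct (Ht (k - K)%nat) as [_ H]. rewrite Hshift in H by assumption.
      replace (S k - K)%nat with (S (k - K)) by lia. assumption.
    + intros k Hk. specialize (Hy (k - K)%nat). rewrite Hshift in Hy by assumption.
      apply Rabs_le. lra.
Qed.

End Hi.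

Lemma ge_above_of_lden c C B : 0 < c -> exists K, forall k, (K <= k)%nat -> B + C <= c * a k.
Proof.
  intro Hc. destruct (lden_unbounded theta cf ((B + C) / c)) as [K HK]. exists K. intros k Hk.
  specialize (HK k Hk). apply Rmult_le_compat_l with (r := c) in HK; [|lra].
  replace (c * ((B + C) / c)) with (B + C) in HK by (field; lra). assumption.
Qed.

Lemma U_not_null_hi tau c c' s : 1 / 2 < c < c' -> c' < 1 -> c * (1 + tau) = tau -> 0 < s <= 1 ->
  0 < theta < 1 ->
  (exists K, forall k, (K <= k)%nat -> s * mu_hi theta cf c' k <= V_hi theta cf c' k) ->
  ~ hausdorff_null s (U_set tau theta).
Proof.
  intros Hc Hc' Htau Hs Hth [K1 HK1].
  pose proof (tau_ge_2c tau c ltac:(lra) Htau) as Ht2.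
  destruct (ge_above_of_lden (tau - 1) 0 (ln 8) ltac:(lra)) as [K2 HK2].
  destruct (lden2_unbounded theta cf (c' - c) (ln 8) ltac:(lra)) as [K3 HK3].
  destruct (ge_above_of_lden tau 1 (- ln (Rmin theta (1 - theta))) ltac:(lra)) as [K4 HK4].
  set (K := max (max K1 K2) (max K3 K4)).
  apply (U_not_null_hi_from tau c c' s K); auto.
  - intros k Hk. apply HK1. lia.
  - intros k Hk. specialize (HK2 k ltac:(lia)). lra.
  - intros k Hk. apply HK3. lia.
  - specialize (HK4 K ltac:(lia)).
    assert (0 < Rmin theta (1 - theta)) by (apply Rmin_glb_lt; lra).
    assert (exp (- tau * a K) < Rmin theta (1 - theta)).
    { rewrite <- (exp_ln (Rmin theta (1 - theta))) by assumption. apply exp_increasing. lra. }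
    pose proof (Rmin_l theta (1 - theta)). pose proof (Rmin_r theta (1 - theta)). lra.
Qed.

End LowerBounds.

(** * Lower bound below the exponent 1 *)

(** A Cantor set with m branches and ratio 1 / (2 m) has dimension ln m / ln (2 m), which exceeds s
    for large m. It serves the case where [U_set] is the whole circle because only finitely many
    levels impose a condition. *)
Lemma in_torus_not_null s : 0 < s < 1 -> ~ hausdorff_null s in_torus.
Proof.
  intro Hs.
  destruct (exists_nat_between (exp (s * ln 2 / (1 - s)))) as (m & Hm & Hm1 & _); [left; apply exp_pos|].
  assert (Hm0 : 1 <= INR m) by (change 1 with (INR 1); apply le_INR; assumption).
  assert (Hln : s * ln (2 * INR m) <= ln (INR m)).
  { rewrite ln_mult by lra.
    assert (s * ln 2 / (1 - s) <= ln (INR m)) as H.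
    { rewrite <- (ln_exp (s * ln 2 / (1 - s))). apply ln_le; [apply exp_pos|lra]. }
    apply Rmult_le_compat_l with (r := 1 - s) in H; [|lra].
    replace ((1 - s) * (s * ln 2 / (1 - s))) with (s * ln 2) in H by (field; lra). lra. }
  assert (Hln2 : 0 < ln 2) by (rewrite <- ln_1; apply ln_increasing; lra).
  assert (Hlm : 0 <= ln (INR m)) by (rewrite <- ln_1; apply ln_le; lra).
  assert (Hl2m : ln 2 <= ln (2 * INR m)) by (apply ln_le; lra).
  set (L := fun k : nat => exp (- ln 2 - INR k * ln (2 * INR m))).
  assert (HLS : forall k, L k = L (S k) * (2 * INR m)).
  { intro k. unfold L. rewrite <- (exp_ln (2 * INR m)) at 3 by lra. rewrite <- exp_plus, S_INR. f_equal. ring. }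
  assert (HL : forall k, 0 < L k) by (intro; apply exp_pos).
  assert (HN : forall k, pprod (fun _ => m) k = exp (INR k * ln (INR m))).
  { induction k as [|k IH]; [simpl; rewrite Rmult_0_l, exp_0; reflexivity|].
    cbn [pprod]. rewrite IH, S_INR, Rmult_plus_distr_r, exp_plus, Rmult_1_l, exp_ln by lra. reflexivity. }
  assert (Hscale : forall k, 1 / 2 <= pprod (fun _ => m) k * Rpower (L k) s).
  { intro k. rewrite HN. unfold L. rewrite Rpower_exp, <- exp_plus.
    apply exp_ge_of_ln_le; [lra|]. unfold Rdiv. rewrite Rmult_1_l, ln_Rinv by lra.
    pose proof (pos_INR k). nra. }
  apply (cantor_tree_not_null R (fun _ x => x) (fun k x => k = 0%nat -> x = 0) (fun _ _ _ => True)
    L (fun k => L (S k)) L (fun _ => m) in_torus s (1 / 2)); auto.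
  - lra.
  - lra.
  - intro k. rewrite (HLS k). specialize (HL (S k)). nra.
  - intros eta Heta.
    destruct (exists_nat_between (Rmax 0 (- ln eta / ln 2))) as (k & _ & Hk & _); [apply Rmax_l|].
    exists k. rewrite <- (exp_ln eta) by assumption. apply exp_increasing.
    assert (- ln eta / ln 2 < INR k) as H by (eapply Rle_lt_trans; [apply Rmax_r|eassumption]).
    apply Rmult_lt_compat_r with (r := ln 2) in H; [|assumption].
    replace (- ln eta / ln 2 * ln 2) with (- ln eta) in H by (field; lra).
    pose proof (pos_INR k). nra.
  - intro k. lra.
  - intro k. right. repeat split; auto. rewrite (HLS k). specialize (HL (S k)). nra.
  - exists 0. auto.
  - intros k x Hx. exists (fun i => x + INR i * (2 * L (S k))). specialize (HL (S k)). split.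
    + intros i Hi. pose proof (pos_INR i). repeat split; try discriminate; [nra|].
      rewrite (HLS k). assert (INR i + 1 <= INR m) by (rewrite <- S_INR; apply le_INR; lia). nra.
    + intros i j Hij. rewrite minus_INR by lia.
      assert (INR i + 1 <= INR j) by (rewrite <- S_INR; apply le_INR; lia). nra.
  - intros t y Ht0 _ Hy. specialize (Hy 0%nat). rewrite Ht0 in Hy by reflexivity.
    assert (L 0%nat = / 2).
    { unfold L. simpl. rewrite Rmult_0_l, Rminus_0_r, exp_Ropp, exp_ln by lra. reflexivity. }
    unfold in_torus. lra.
Qed.

Section LowerBoundLo.
Variables (theta : R) (cf : convergents theta).
Local Notation q := (den cf).
Local Notation p := (numer cf).
Local Notation D := (err cf).
Local Notation sg := (sgn cf).
Local Notation a := (lden theta cf).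
Local Notation b := (lden2 theta cf).

(* [y] lies in the cluster of some [n theta - m], on the side towards which the points
   [(n + i q k) theta - (m + i p k)] move. *)
Definition in_cluster (k : nat) (r y : R) : Prop :=
  exists n m : Z, (1 <= n <= q k)%Z /\ 0 <= sg k * (y - (IZR n * theta - IZR m)) <= r.

Section Lo.
Variables (tau c : R) (K : nat).
Hypotheses (Hc : 0 < c < 1 / 2) (Htau : 0 < tau) (Htau1 : tau * (1 - c) < c).
Hypothesis (Hgap : forall k, (K <= k)%nat -> 2 * ln 256 <= (1 - 2 * c) * b k).
Hypothesis (Hslack : forall k, (K <= k)%nat -> ln 2 <= (c / (1 - c) - tau) * a k).

Let Hsel_gap k : (K <= k)%nat -> a k < c * b k -> ln 256 <= a (S k) - a k.
Proof.
  intros Hk Hsel. specialize (Hgap k Hk). unfold lden2 in *.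
  assert (0 < ln 256) by (rewrite <- ln_1; apply ln_increasing; lra). nra.
Qed.

Let Htau_le1 : tau < 1.
Proof. assert (tau * (1 - c) < 1 * (1 - c)) by lra. nra. Qed.

(** Only levels with a_k < c b_k restrict y. At the others the shadowed grid of step 1 / q_k
    approximates every y to within 2 / q_k, and c a_{k+1} <= (1 - c) a_k makes this less than
    Q^(-tau) for all Q < q_{k+1}. *)
Lemma U_set_of_clusters y : in_torus y ->
  (forall k, (K <= k)%nat -> a k < c * b k -> in_cluster k (exp (- c * b k) / 8) y) -> U_set tau theta y.
Proof.
  intros Hy Hcl. apply U_set_iff. split; [assumption|].
  exists (exp (a K)). intros Q HQ. apply Rge_le in HQ.
  destruct (exists_level theta cf K Q HQ) as (k & Hk & Hu1 & Hu2).
  assert (HQ0 : 0 < Q) by (pose proof (exp_pos (a K)); lra).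
  unfold approximable, Rpower. set (u := ln Q) in *.
  assert (HQu : Q = exp u) by (symmetry; apply exp_ln, HQ0).
  assert (HkQ : IZR (q k) <= Q) by (rewrite HQu, <- (exp_lden theta cf); apply exp_le; assumption).
  pose proof (lden_ge0 theta cf k) as Ha0. pose proof (lden_S theta cf k) as HaS.
  assert (Hua : exp (- a (S k)) <= exp (- tau * u)) by (apply exp_le; nra).
  destruct (Rlt_le_dec (a k) (c * b k)) as [Hsel|Hun].
  - destruct (Hcl k Hk Hsel) as (n & m & [Hn1 Hn2] & Hw1 & Hw2).
    pose proof (err_pos cf k) as HD. pose proof (err_le_exp theta cf k) as HD2.
    apply IZR_le in Hn2.
    set (w := sg k * (y - (IZR n * theta - IZR m))) in *.
    destruct (Rlt_le_dec (exp (- c * b k) / 8) (exp (- tau * u))) as [Hlt|Hge].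
    + exists n, m. split; [assumption|]. split; [lra|].
      replace (Rabs (IZR n * theta - IZR m - y)) with (Rabs w).
      * rewrite Rabs_pos_eq; lra.
      * unfold w. rewrite Rabs_mult, abs_sgn, Rmult_1_l, Rabs_minus_sym. reflexivity.
    + assert (Hlb : (1 - c) * b k <= u).
      { assert (- tau * u <= - c * b k) as H.
        { rewrite <- (ln_exp (- tau * u)), <- (ln_exp (- c * b k)). apply ln_le; [apply exp_pos|].
          pose proof (exp_pos (- c * b k)). lra. }
        pose proof (lden2_ge0 theta cf k).
        assert (tau * ((1 - c) * b k) <= tau * u) by nra. nra. }
      (* Once Q^(-tau) is below the cluster size, steps of length D_k starting at the cluster centre
         bring the orbit within D_k of y. The one-sided cluster makes z nonnegative, so the index
         stays positive. *)
      set (z := Int_part (w / D k)). destruct (base_Int_part (w / D k)) as [Hz1 Hz2]. fold z in Hz1, Hz2.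
      assert (Hwd : 0 <= w / D k) by (apply Rmult_le_pos; [assumption|left; apply Rinv_0_lt_compat; assumption]).
      assert (Hz0 : (0 <= z)%Z).
      { assert (-1 < z)%Z; [|lia]. apply lt_IZR. lra. }
      assert (Hzd1 : IZR z * D k <= w).
      { apply Rmult_le_compat_r with (r := D k) in Hz1; [|lra].
        replace (w / D k * D k) with w in Hz1 by (field; lra). assumption. }
      assert (Hzd2 : w < IZR z * D k + D k).
      { assert (w / D k < IZR z + 1) as H by lra. apply Rmult_lt_compat_r with (r := D k) in H; [|assumption].
        replace (w / D k * D k) with w in H by (field; lra). lra. }
      exists (n + z * q k)%Z, (m + z * p k)%Z.
      pose proof (den_ge1 theta cf k) as Hq1. split; [nia|].
      rewrite !plus_IZR, !mult_IZR. apply IZR_le in Hz0. split.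
      (* The index n + z q_k is at most Q / 2 + Q / 4. *)
      * assert (2 * IZR (q k) <= Q).
        { rewrite HQu, <- (exp_lden theta cf), <- (exp_ln 2), <- exp_plus by lra. apply exp_le.
          specialize (Hsel_gap k Hk Hsel). pose proof (lden2_ge0 theta cf k).
          assert (2 * ln 2 <= ln 256).
          { replace (2 * ln 2) with (ln (2 * 2)) by (rewrite ln_mult by lra; ring). apply ln_le; lra. }
          assert (1 / 2 * b k <= (1 - c) * b k) by nra. unfold lden2 in *. lra. }
        assert (IZR z * IZR (q k) <= exp u / 4).
        { pose proof (err_ge_exp theta cf k).
          assert (HzD : IZR z * exp (- a (S k)) <= exp (- c * b k) / 4) by nra.
          apply Rmult_le_compat_r with (r := exp (b k)) in HzD; [|left; apply exp_pos].
          replace (IZR z * exp (- a (S k)) * exp (b k)) with (IZR z * IZR (q k)) in HzD.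
          2:{ rewrite <- (exp_lden theta cf), Rmult_assoc, <- exp_plus. do 2 f_equal. unfold lden2. ring. }
          replace (exp (- c * b k) / 4 * exp (b k)) with (exp ((1 - c) * b k) / 4) in HzD.
          2:{ unfold Rdiv. rewrite Rmult_assoc, (Rmult_comm (/ 4)), <- Rmult_assoc, <- exp_plus. do 2 f_equal. ring. }
          pose proof (exp_le _ _ Hlb). lra. }
        rewrite <- HQu in *. lra.
      * replace ((IZR n + IZR z * IZR (q k)) * theta - (IZR m + IZR z * IZR (p k)) - y)
          with (- (y - (IZR n * theta - IZR m)) + IZR z * (IZR (q k) * theta - IZR (p k))) by ring.
        rewrite err_eq. unfold w in *.
        destruct (sgn_pm1 cf k) as [E|E]; rewrite E in *; unfold Rabs; destruct Rcase_abs; lra.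
  - set (j := Int_part (y * IZR (q k))). destruct (base_Int_part (y * IZR (q k))) as [Hj1 Hj2]. fold j in Hj1, Hj2.
    destruct (orbit_near_rational theta cf k j) as (n & m & [Hn1 Hn2] & Hnm). apply IZR_le in Hn2.
    exists n, m. split; [assumption|]. split; [lra|].
    pose proof (den_IZR_ge1 theta cf k) as Hq1.
    assert (Hjy : Rabs (IZR j / IZR (q k) - y) <= exp (- a k)).
    { rewrite exp_neg_lden.
      replace (IZR j / IZR (q k) - y) with (- ((y * IZR (q k) - IZR j) * / IZR (q k))) by (field; lra).
      rewrite Rabs_Ropp, Rabs_mult, !Rabs_pos_eq; [|left; apply Rinv_0_lt_compat; lra|lra].
      rewrite <- (Rmult_1_l (/ IZR (q k))) at 2. apply Rmult_le_compat_r; [left; apply Rinv_0_lt_compat; lra|lra]. }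
    rewrite <- exp_neg_lden in Hnm.
    assert (exp (- a (S k)) <= exp (- a k)) by (apply exp_le; lra).
    replace (IZR n * theta - IZR m - y) with ((IZR n * theta - IZR m - IZR j / IZR (q k)) + (IZR j / IZR (q k) - y)) by ring.
    eapply Rle_lt_trans; [apply Rabs_triang|].
    apply Rle_lt_trans with (2 * exp (- a k)); [lra|].
    rewrite <- (exp_ln 2) at 1 by lra. rewrite <- exp_plus. apply exp_increasing.
    specialize (Hslack k Hk).
    assert (c / (1 - c) * a (S k) <= a k).
    { apply Rmult_le_reg_r with (1 - c); [lra|].
      replace (c / (1 - c) * a (S k) * (1 - c)) with (c * a (S k)) by (field; lra). unfold lden2 in Hun. lra. }
    assert (tau < c / (1 - c)).
    { apply Rmult_lt_reg_r with (1 - c); [lra|]. unfold Rdiv. rewrite Rmult_assoc, Rinv_l; lra. }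
    nra.
Qed.

Variables (c' s : R).
Hypotheses (Hc' : c < c' < 1 / 2) (Hs : 0 < s < 1).
Hypothesis (HV : forall k, (K <= k)%nat -> s * mu_lo theta cf c' k <= V_lo theta cf c' k).
Hypothesis (Hgap' : forall k, (K <= k)%nat -> ln 32 <= (c' - c) * b k).
Hypothesis (Hroot : 64 <= exp (a K)).
Hypothesis (Hinf : forall k, exists k', (k <= k')%nat /\ a k' < c * b k').

Let sel k : bool := if Rlt_dec (a k) (c * b k) then true else false.

Let selP k : reflect (a k < c * b k) (sel k).
Proof. unfold sel. destruct Rlt_dec; constructor; assumption. Qed.

(** The length changes only at restricting levels, where it becomes the one-sided cluster size
    required by [U_set_of_clusters]; at the other levels a node has itself as only child. *)
Fixpoint node_len (k : nat) : R :=
  match k with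
  | O => 1 / 2
  | S k => if sel (K + k) then exp (- c * b (K + k)%nat) / 8 else node_len k
  end.

(** An interval of this length holds about [node_len k] times q_k grid points; the 3 removed leave
    room at both ends for the shadowing error and for the length of the child. *)
Let br (k : nat) : nat := if sel (K + k) then floor1 (node_len k * exp (a (K + k)%nat) - 3) else 1%nat.

Let node_len_ge k : 32 * exp (- a (K + k)%nat) <= node_len k.
Proof.
  induction k as [|k IH].
  - rewrite Nat.add_0_r. simpl. apply Rmult_le_reg_r with (exp (a K)); [apply exp_pos|].
    rewrite Rmult_assoc, <- exp_plus, Rplus_opp_l, exp_0. lra.
  - rewrite Nat.add_succ_r. cbn [node_len]. pose proof (lden_S theta cf (K + k)) as HaS.
    destruct (selP (K + k)) as [Hk|Hk].
    + assert (256 * exp (- a (S (K + k))) <= exp (- c * b (K + k)%nat)); [|lra].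
      rewrite <- (exp_ln 256), <- exp_plus by lra. apply exp_le.
      specialize (Hgap (K + k)%nat ltac:(lia)). unfold lden2 in *. nra.
    + apply Rle_trans with (32 * exp (- a (K + k)%nat)); [|assumption].
      apply Rmult_le_compat_l; [lra|]. apply exp_le. lra.
Qed.

Let node_len_pos k : 0 < node_len k.
Proof. pose proof (node_len_ge k). pose proof (exp_pos (- a (K + k)%nat)). lra. Qed.

Let node_len_eighth k : a (K + k)%nat < c * b (K + k)%nat -> node_len (S k) <= exp (- a (K + k)%nat) / 8.
Proof.
  intro Hk. cbn [node_len]. destruct (selP (K + k)) as [_|H]; [|tauto].
  assert (exp (- c * b (K + k)%nat) <= exp (- a (K + k)%nat)) by (apply exp_le; lra). lra.
Qed.

Let node_len_decr k : node_len (S k) <= node_len k.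
Proof.
  destruct (selP (K + k)) as [Hk|Hk].
  - pose proof (node_len_eighth k Hk). pose proof (node_len_ge k). pose proof (exp_pos (- a (K + k)%nat)). lra.
  - cbn [node_len]. destruct (selP (K + k)); [tauto|lra].
Qed.

Let scaled_len k : 32 <= node_len k * exp (a (K + k)%nat).
Proof.
  pose proof (node_len_ge k) as H. apply Rmult_le_compat_r with (r := exp (a (K + k)%nat)) in H; [|left; apply exp_pos].
  rewrite Rmult_assoc, <- exp_plus, Rplus_opp_l, exp_0 in H. lra.
Qed.

Let br_le k : a (K + k)%nat < c * b (K + k)%nat -> INR (br k) <= node_len k * exp (a (K + k)%nat) - 3.
Proof.
  intro Hk. unfold br. destruct (selP (K + k)) as [_|H]; [|tauto].
  pose proof (scaled_len k).
  destruct (floor1_spec (node_len k * exp (a (K + k)%nat) - 3)) as [[E|[_ H2]] _]; [lra|rewrite E; simpl; lra|assumption].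
Qed.

Let br_ge k : a (K + k)%nat < c * b (K + k)%nat -> node_len k * exp (a (K + k)%nat) / 4 <= INR (br k).
Proof.
  intro Hk. unfold br. destruct (selP (K + k)) as [_|H]; [|tauto].
  pose proof (scaled_len k).
  destruct (floor1_spec (node_len k * exp (a (K + k)%nat) - 3)) as [_ H1]; lra.
Qed.

Let br_ge1 k : (1 <= br k)%nat.
Proof. unfold br. destruct sel; [apply floor1_ge1|lia]. Qed.

Let loss (j : nat) := Rmax 0 (c' * b j - a j).

(** Total length again, now from below. A restricting level costs 1/4 from the branching and 1/8
    from the length; the slack c' - c repays this 32, so the loss is measured at c'. *)
Let mass_ge k : exp (psum loss K - psum loss (K + k)) / 2 <= pprod br k * node_len k.
Proof.
  induction k as [|k IH].
  - rewrite Nat.add_0_r, Rminus_diag, exp_0. simpl. lra.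
  - rewrite Nat.add_succ_r. cbn [psum pprod]. set (S1 := psum loss K) in *. set (S2 := psum loss (K + k)) in *.
    pose proof (pprod_pos br k br_ge1) as HN. pose proof (node_len_pos k) as HL.
    replace (S1 - (S2 + loss (K + k))) with ((S1 - S2) + - loss (K + k)) by ring. rewrite exp_plus.
    pose proof (exp_pos (S1 - S2)). pose proof (exp_pos (- loss (K + k))).
    destruct (selP (K + k)) as [Hk|Hk].
    + pose proof (br_ge k Hk) as Hb. cbn [node_len]. destruct (selP (K + k)) as [_|H1]; [|tauto].
      assert (exp (- loss (K + k)) <= exp (a (K + k)%nat) / 4 * (exp (- c * b (K + k)%nat) / 8)) as Hl.
      { assert (32 * exp (- loss (K + k)) <= exp (a (K + k)%nat) * exp (- c * b (K + k)%nat)); [|lra].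
        rewrite <- (exp_ln 32), <- !exp_plus by lra. apply exp_le.
        specialize (Hgap' (K + k)%nat ltac:(lia)). unfold loss.
        rewrite Rmax_right by (pose proof (lden2_mul_le theta cf c c' (K + k) ltac:(lra)); lra). lra. }
      apply Rle_trans with (pprod br k * (node_len k * exp (a (K + k)%nat) / 4) * (exp (- c * b (K + k)%nat) / 8)).
      * replace (pprod br k * (node_len k * exp (a (K + k)%nat) / 4) * (exp (- c * b (K + k)%nat) / 8))
          with (pprod br k * node_len k * (exp (a (K + k)%nat) / 4 * (exp (- c * b (K + k)%nat) / 8))) by field.
        replace (exp (S1 - S2) * exp (- loss (K + k)) / 2) with (exp (S1 - S2) / 2 * exp (- loss (K + k))) by field.
        apply Rmult_le_compat; lra.
      * apply Rmult_le_compat_r; [pose proof (exp_pos (- c * b (K + k)%nat)); lra|].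
        apply Rmult_le_compat_l; lra.
    + cbn [node_len]. assert (br k = 1%nat) as -> by (unfold br; destruct (selP (K + k)); [tauto|reflexivity]).
      destruct (selP (K + k)) as [H1|_]; [tauto|]. simpl INR. rewrite Rmult_1_r.
      assert (exp (- loss (K + k)) <= 1).
      { rewrite <- exp_0. apply exp_le. unfold loss. pose proof (Rmax_l 0 (c' * b (K + k)%nat - a (K + k)%nat)). lra. }
      nra.
Qed.

(** Just after a restricting level the node number is at least exp (s c b_k) / 8 by [mass_ge] and
    [HV], and the length to the power s is at least exp (- s c b_k) / 8. At other levels neither
    factor changes. *)
Let Hscale k : 1 / 64 <= pprod br k * Rpower (node_len k) s.
Proof.
  induction k as [|k IH].
  - simpl. pose proof (le_Rpower s (1 / 2) ltac:(lra) ltac:(lra)). lra.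
  - cbn [pprod node_len]. destruct (selP (K + k)) as [Hk|Hk].
    + pose proof (pprod_pos br k br_ge1) as HN.
      assert (HN' : exp (s * (c * b (K + k)%nat)) / 8 <= pprod br k * INR (br k)).
      { apply Rle_trans with (pprod br k * (node_len k * exp (a (K + k)%nat) / 4)); [|apply Rmult_le_compat_l; [lra|apply br_ge, Hk]].
        apply Rle_trans with (exp (psum loss K - psum loss (K + k)) / 2 * (exp (a (K + k)%nat) / 4)).
        - replace (exp (psum loss K - psum loss (K + k)) / 2 * (exp (a (K + k)%nat) / 4))
            with (exp (psum loss K - psum loss (K + k)) * exp (a (K + k)%nat) / 8) by field.
          rewrite <- exp_plus.
          assert (exp (s * (c * b (K + k)%nat)) <= exp (psum loss K - psum loss (K + k) + a (K + k)%nat)); [|lra].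
          apply exp_le. specialize (HV (K + k)%nat ltac:(lia)). unfold V_lo, mu_lo in HV. fold loss in HV.
          pose proof (Rmax_r (a (K + k)%nat) (c' * b (K + k)%nat)).
          pose proof (lden2_mul_le theta cf c c' (K + k) ltac:(lra)).
          assert (0 <= psum loss K).
          { apply Rle_trans with (psum (fun _ => 0) K); [rewrite psum_const; lra|].
            apply psum_le. intros. apply Rmax_l. }
          nra.
        - replace (pprod br k * (node_len k * exp (a (K + k)%nat) / 4))
            with (pprod br k * node_len k * (exp (a (K + k)%nat) / 4)) by field.
          apply Rmult_le_compat_r; [pose proof (exp_pos (a (K + k)%nat)); lra|apply mass_ge]. }
      assert (HP : exp (- (s * (c * b (K + k)%nat))) / 8 <= Rpower (exp (- c * b (K + k)%nat) / 8) s).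
      { unfold Rdiv. rewrite <- Rpower_mult_distr by (try apply exp_pos; lra). rewrite Rpower_exp.
        replace (s * (- c * b (K + k)%nat)) with (- (s * (c * b (K + k)%nat))) by ring.
        apply Rmult_le_compat_l; [left; apply exp_pos|]. apply le_Rpower; lra. }
      pose proof (exp_pos (s * (c * b (K + k)%nat))). pose proof (exp_pos (- (s * (c * b (K + k)%nat)))).
      apply Rle_trans with (exp (s * (c * b (K + k)%nat)) / 8 * (exp (- (s * (c * b (K + k)%nat))) / 8)).
      * assert (exp (s * (c * b (K + k)%nat)) * exp (- (s * (c * b (K + k)%nat))) = 1)
          by (rewrite <- exp_plus, Rplus_opp_r; apply exp_0). lra.
      * apply Rmult_le_compat; lra.
    + assert (br k = 1%nat) as -> by (unfold br; destruct (selP (K + k)); [tauto|reflexivity]).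
      simpl INR. rewrite Rmult_1_r. assumption.
Qed.

Lemma U_not_null_lo_from : ~ hausdorff_null s (U_set tau theta).
Proof.
  apply (cantor_tree_not_null R (fun _ x => x) (fun k x => k = 0%nat -> x = 1 / 4)
    (fun k x x' => a (K + k)%nat < c * b (K + k)%nat ->
       exists z, orbit_pt theta cf (K + k) z /\ x' = z - (if Rlt_dec 0 (sg (K + k)%nat) then 0 else node_len (S k)))
    node_len (fun k => if sel (K + k) then exp (- a (K + k)%nat) / 2 else node_len (S k)) node_len br
    (U_set tau theta) s (1 / 64)); auto.
  - lra.
  - lra.
  - intros eta Heta.
    destruct (lden2_unbounded theta cf c (- ln eta) ltac:(lra)) as [K1 HK1].
    destruct (Hinf (K + K1)) as (k' & Hk' & Hselk).
    exists (S (k' - K)). cbn [node_len]. replace (K + (k' - K))%nat with k' by lia.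
    destruct (selP k') as [_|]; [|tauto].
    assert (exp (- c * b k') <= eta).
    { apply exp_le_of_le_ln; [assumption|]. specialize (HK1 k' ltac:(lia)). lra. }
    lra.
  - intro k. destruct (selP (K + k)) as [Hk|Hk]; [|lra].
    pose proof (node_len_eighth k Hk). pose proof (exp_pos (- a (K + k)%nat)). lra.
  - intro k. destruct (selP (K + k)) as [Hk|Hk].
    + right. split; [apply node_len_pos|]. split; [|apply Hscale].
      apply Rle_trans with (node_len k * exp (a (K + k)%nat) / 4 * (exp (- a (K + k)%nat) / 2)).
      * replace (node_len k * exp (a (K + k)%nat) / 4 * (exp (- a (K + k)%nat) / 2))
          with (node_len k * (exp (a (K + k)%nat) * exp (- a (K + k)%nat)) / 8) by field.
        rewrite <- exp_plus, Rplus_opp_r, exp_0. pose proof (node_len_pos k). lra.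
      * apply Rmult_le_compat_r; [pose proof (exp_pos (- a (K + k)%nat)); lra|apply br_ge, Hk].
    + left. unfold br. destruct (selP (K + k)); [tauto|reflexivity].
  - exists (1 / 4). reflexivity.
  - intros k x _. set (k' := (K + k)%nat).
    destruct (selP k') as [Hk|Hk].
    2:{ exists (fun _ => x). assert (br k = 1%nat) as -> by (unfold br; fold k'; destruct (selP k'); [tauto|reflexivity]).
        split; [|intros; lia]. intros i Hi. pose proof (node_len_decr k).
        repeat split; try discriminate; [tauto|lra|lra]. }
    pose proof (br_le k Hk) as Hb1. fold k' in Hb1.
    (* The child starts at the orbit point for positive sign and ends there for negative sign, the
       side on which [in_cluster] wants y. *)
    set (off := if Rlt_dec 0 (sg k') then 0 else node_len (S k)).
    assert (Hoff : 0 <= off <= node_len (S k)) by (unfold off; pose proof (node_len_pos (S k)); destruct Rlt_dec; lra).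
    pose proof (node_len_eighth k Hk) as HL8. fold k' in HL8.
    set (iq := exp (- a k')) in *. assert (Hiq : 0 < iq) by apply exp_pos.
    assert (Hq : exp (a k') * iq = 1) by (unfold iq; rewrite <- exp_plus, Rplus_opp_r; apply exp_0).
    pose proof (exp_pos (a k')) as Hqp. set (qq := exp (a k')) in *.
    assert (forall j : Z, exists z, orbit_pt theta cf k' z /\ Rabs (z - IZR j * iq) <= iq / 8) as Hz.
    { intro j. destruct (orbit_near_rational theta cf k' j) as (n & m & Hn & Hnm).
      exists (IZR n * theta - IZR m). split; [exists n, m; auto|].
      rewrite <- !exp_neg_lden in Hnm. fold iq in Hnm. unfold Rdiv in Hnm. rewrite <- exp_neg_lden in Hnm. fold iq in Hnm.
      eapply Rle_trans; [apply Hnm|].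
      assert (256 * exp (- a (S k')) <= iq); [|pose proof (exp_pos (- a (S k'))); lra].
      unfold iq. rewrite <- (exp_ln 256), <- exp_plus by lra. apply exp_le.
      pose proof (Hsel_gap k' ltac:(unfold k'; lia) Hk). lra. }
    set (z := fun j => proj1_sig (constructive_indefinite_description _ (Hz j))).
    assert (Hz1 : forall j, orbit_pt theta cf k' (z j)) by (intro j; apply (proj2_sig (constructive_indefinite_description _ (Hz j)))).
    assert (Hz2 : forall j, IZR j * iq - iq / 8 <= z j <= IZR j * iq + iq / 8).
    { intro j. assert (Rabs (z j - IZR j * iq) <= iq / 8) as H
        by apply (proj2_sig (constructive_indefinite_description _ (Hz j))).
      revert H. unfold Rabs. destruct Rcase_abs; lra. }
    (* Starting one grid step beyond the first grid point after x leaves at least 1 / q_k on the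
       left. *)
    destruct (archimed (x * qq)) as [Hj1 Hj2]. set (j0 := (up (x * qq) + 1)%Z).
    assert (Hj0 : x * qq + 1 < IZR j0 <= x * qq + 2) by (unfold j0; rewrite plus_IZR; lra).
    assert (Hxq : x * qq * iq = x) by (rewrite Rmult_assoc, Hq; ring).
    assert (HLq : node_len k * qq * iq = node_len k) by (rewrite Rmult_assoc, Hq; ring).
    exists (fun i => z (j0 + Z.of_nat i)%Z - off). split.
    + intros i Hi. specialize (Hz2 (j0 + Z.of_nat i)%Z). rewrite plus_IZR, <- INR_IZR_INZ in Hz2.
      assert (INR i + 1 <= INR (br k)) by (rewrite <- S_INR; apply le_INR; lia). pose proof (pos_INR i).
      split; [discriminate|]. split; [intros _; exists (z (j0 + Z.of_nat i)%Z); split; [apply Hz1|reflexivity]|].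
      assert (x + iq <= (IZR j0 + INR i) * iq) by nra.
      assert ((IZR j0 + INR i) * iq <= x + node_len k - 2 * iq + iq) by nra.
      lra.
    + intros i j Hij. pose proof (Hz2 (j0 + Z.of_nat i)%Z) as Hi. pose proof (Hz2 (j0 + Z.of_nat j)%Z) as Hj.
      rewrite plus_IZR, <- INR_IZR_INZ in Hi, Hj. rewrite minus_INR by lia.
      assert (INR i + 1 <= INR j) by (rewrite <- S_INR; apply le_INR; lia). nra.
  - intros t y Ht0 Ht Hy.
    apply U_set_of_clusters.
    + specialize (Hy 0%nat). rewrite Ht0 in Hy by reflexivity. simpl in Hy. unfold in_torus. lra.
    + intros k Hk Hselk. destruct (Ht (k - K)%nat) as [_ Hch].
      pose proof (Hy (S (k - K))) as Hyk. cbn [node_len] in Hyk, Hch. replace (K + (k - K))%nat with k in * by lia.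
      destruct (selP k) as [_|]; [|tauto].
      destruct (Hch Hselk) as (z & (n & m & Hn & ->) & E). rewrite E in Hyk.
      exists n, m. split; [assumption|].
      destruct (sgn_pm1 cf k) as [E2|E2]; rewrite E2 in *;
        [destruct (Rlt_dec 0 1); [|lra] | destruct (Rlt_dec 0 (-1)); [lra|]]; lra.
Qed.

End Lo.

Lemma U_not_null_lo tau c c' s : 0 < c < c' -> c' < 1 / 2 -> 0 < tau -> tau * (1 - c) < c -> 0 < s < 1 ->
  (exists K, forall k, (K <= k)%nat -> s * mu_lo theta cf c' k <= V_lo theta cf c' k) ->
  ~ hausdorff_null s (U_set tau theta).
Proof.
  intros Hc Hc' Htau Htau1 Hs [K1 HK1].
  assert (Htc : tau < c / (1 - c)).
  { apply Rmult_lt_reg_r with (1 - c); [lra|]. unfold Rdiv. rewrite Rmult_assoc, Rinv_l; lra. }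
  destruct (lden2_unbounded theta cf (1 - 2 * c) (2 * ln 256) ltac:(lra)) as [K2 HK2].
  destruct (ge_above_of_lden theta cf (c / (1 - c) - tau) 0 (ln 2) ltac:(lra)) as [K3 HK3].
  destruct (lden2_unbounded theta cf (c' - c) (ln 32) ltac:(lra)) as [K4 HK4].
  destruct (lden_unbounded theta cf (ln 64)) as [K5 HK5].
  set (K := max (max K1 K2) (max K3 (max K4 K5))).
  assert (Hslack : forall k, (K <= k)%nat -> ln 2 <= (c / (1 - c) - tau) * a k).
  { intros k Hk. specialize (HK3 k ltac:(lia)). lra. }
  (* Infinitely many restricting levels are what makes the node lengths tend to 0; otherwise [U_set]
     contains the whole circle. *)
  destruct (classic (forall k, exists k', (k <= k')%nat /\ a k' < c * b k')) as [Hinf|Hfin].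
  - apply (U_not_null_lo_from tau c K) with c'; auto; try lra.
    + intros k Hk. apply HK2. lia.
    + intros k Hk. apply HK1. lia.
    + intros k Hk. apply HK4. lia.
    + apply exp_ge_of_ln_le; [lra|]. apply HK5. lia.
  - intro Hnull. apply (in_torus_not_null s Hs).
    apply not_all_ex_not in Hfin. destruct Hfin as [K6 HK6].
    revert Hnull. apply null_subset. intros y Hy.
    apply (U_set_of_clusters tau c (max K K6)); auto; try lra.
    + intros k Hk. apply HK2. lia.
    + intros k Hk. apply Hslack. lia.
    + intros k Hk Hselk. exfalso. apply HK6. exists k. split; [lia|assumption].
Qed.

End LowerBoundLo.

(** * Continuity *)

Lemma psum_telescope f k : psum (fun j => f (S j) - f j) k = f k - f 0%nat.
Proof. induction k; simpl; [ring|]. rewrite IHk. ring. Qed.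

Lemma psum_minus f g k : psum (fun j => f j - g j) k = psum f k - psum g k.
Proof. induction k; simpl; [ring|]. rewrite IHk. ring. Qed.

Lemma Rdiv_le_of_le_mul x y z : 0 < y -> x <= z * y -> x / y <= z.
Proof. intros Hy H. apply Rmult_le_reg_r with y; [assumption|]. unfold Rdiv. rewrite Rmult_assoc, Rinv_l; lra. Qed.

Section Continuity.
Variables (theta : R) (cf : convergents theta).
Local Notation a := (lden theta cf).
Local Notation b := (lden2 theta cf).
Local Notation U := (fun t => U_set t theta).

Lemma V_lo_continuous c c' k : 0 < c <= c' -> c' < 1 / 2 ->
  V_lo theta cf c k - (c' - c) / (1 - 2 * c') * a k <= V_lo theta cf c' k.
Proof.
  intros Hc Hc'. unfold V_lo.
  assert (Hr : 0 <= (c' - c) / (1 - 2 * c')) by (apply Rmult_le_pos; [lra|left; apply Rinv_0_lt_compat; lra]).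
  assert (psum (fun j => Rmax 0 (c' * b j - a j) - Rmax 0 (c * b j - a j)) k
    <= psum (fun j => (c' - c) / (1 - 2 * c') * (a (S j) - a j)) k) as H.
  { apply psum_le. intros j _. pose proof (lden_S theta cf j) as HS. pose proof (lden2_ge0 theta cf j).
    unfold Rmax at 1. destruct Rle_dec as [Hj|Hj].
    - pose proof (Rmax_r 0 (c * b j - a j)).
      assert ((1 - 2 * c') * b j <= a (S j) - a j) by (unfold lden2 in *; lra).
      apply Rle_trans with ((c' - c) / (1 - 2 * c') * ((1 - 2 * c') * b j)).
      + replace ((c' - c) / (1 - 2 * c') * ((1 - 2 * c') * b j)) with ((c' - c) * b j) by (field; lra). lra.
      + apply Rmult_le_compat_l; assumption.
    - pose proof (Rmax_l 0 (c * b j - a j)).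
      assert (0 <= (c' - c) / (1 - 2 * c') * (a (S j) - a j)) by (apply Rmult_le_pos; lra). lra. }
  rewrite psum_minus, psum_scal, psum_telescope in H. pose proof (lden_ge0 theta cf 0). nra.
Qed.

Lemma V_hi_continuous c c' k : 1 / 2 < c <= c' ->
  V_hi theta cf c k - (c' - c) / (2 * c - 1) * a k <= V_hi theta cf c' k.
Proof.
  intros Hc. unfold V_hi.
  assert (Hr : 0 <= (c' - c) / (2 * c - 1)) by (apply Rmult_le_pos; [lra|left; apply Rinv_0_lt_compat; lra]).
  assert (psum (fun j => Rmax 0 (a (S j) - c * b j) - Rmax 0 (a (S j) - c' * b j)) k
    <= psum (fun j => (c' - c) / (2 * c - 1) * (a (S j) - a j)) k) as H.
  { apply psum_le. intros j _. pose proof (lden_S theta cf j) as HS. pose proof (lden2_ge0 theta cf j).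
    unfold Rmax at 1. destruct Rle_dec as [Hj|Hj].
    - pose proof (Rmax_r 0 (a (S j) - c' * b j)).
      assert ((2 * c - 1) * b j <= a (S j) - a j) by (unfold lden2 in *; lra).
      apply Rle_trans with ((c' - c) / (2 * c - 1) * ((2 * c - 1) * b j)).
      + replace ((c' - c) / (2 * c - 1) * ((2 * c - 1) * b j)) with ((c' - c) * b j) by (field; lra). lra.
      + apply Rmult_le_compat_l; assumption.
    - pose proof (Rmax_l 0 (a (S j) - c' * b j)).
      assert (0 <= (c' - c) / (2 * c - 1) * (a (S j) - a j)) by (apply Rmult_le_pos; lra). lra. }
  rewrite psum_minus, psum_scal, psum_telescope in H. pose proof (lden_ge0 theta cf 0). nra.
Qed.

Lemma mu_lo_continuous c c' k : 0 < c <= c' -> mu_lo theta cf c' k <= c' / c * mu_lo theta cf c k.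
Proof.
  intro Hc. assert (1 <= c' / c).
  { apply Rmult_le_reg_r with c; [lra|]. unfold Rdiv. rewrite Rmult_assoc, Rinv_l; lra. }
  pose proof (lden_ge0 theta cf k). pose proof (lden2_ge0 theta cf k). unfold mu_lo.
  pose proof (Rmax_l (a k) (c * b k)). pose proof (Rmax_r (a k) (c * b k)).
  apply Rmax_lub.
  - apply Rle_trans with (1 * Rmax (a k) (c * b k)); [lra|]. apply Rmult_le_compat_r; lra.
  - replace (c' * b k) with (c' / c * (c * b k)) by (field; lra). apply Rmult_le_compat_l; lra.
Qed.

Lemma mu_hi_continuous c c' k : 0 < c <= c' -> c' < 1 ->
  mu_hi theta cf c' k <= c' * (1 - c) / (c * (1 - c')) * mu_hi theta cf c k.
Proof.
  intros Hc Hc'. pose proof (lden_ge0 theta cf k). pose proof (lden2_ge0 theta cf k). unfold mu_hi.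
  pose proof (Rmax_l (c / (1 - c) * a k) (c * b k)). pose proof (Rmax_r (c / (1 - c) * a k) (c * b k)).
  assert (Hr : c' / c <= c' * (1 - c) / (c * (1 - c'))).
  { apply Rdiv_le_of_le_mul; [lra|].
    replace (c' * (1 - c) / (c * (1 - c')) * c) with (c' * ((1 - c) / (1 - c'))) by (field; lra).
    rewrite <- (Rmult_1_r c') at 1. apply Rmult_le_compat_l; [lra|].
    apply Rmult_le_reg_r with (1 - c'); [lra|]. unfold Rdiv. rewrite Rmult_assoc, Rinv_l; lra. }
  assert (0 < c' / c) by (apply Rdiv_lt_0_compat; lra).
  apply Rmax_lub.
  - replace (c' / (1 - c') * a k) with (c' * (1 - c) / (c * (1 - c')) * (c / (1 - c) * a k)) by (field; lra).
    apply Rmult_le_compat_l; lra.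
  - apply Rle_trans with (c' / c * (c * b k)); [right; field; lra|].
    apply Rmult_le_compat; try lra. apply Rmult_le_pos; lra.
Qed.

(* Says that the dimension at [t2] is at least the dimension at [t1] minus [2 eta]. *)
Definition dim_drop_le (eta t1 t2 : R) : Prop :=
  forall d, (forall s, 0 <= s -> hausdorff_null s (U t1) -> d <= s) ->
  forall s, 0 < s < 1 -> s <= d - 2 * eta -> ~ hausdorff_null s (U t2).

(** If V <= (s + eta) mu held infinitely often, the set at t1 would be null at s + 3 eta / 2 < d. So
    V > (s + eta) mu from some level on, and replacing V, mu by V', mu' costs at most (A + rho - 1)
    mu <= eta mu, because a <= mu and s < 1. *)
Lemma dim_drop_of_rates (V V' mu mu' : nat -> R) A rho eta t1 t2 :
  0 < eta -> 0 <= A -> 1 <= rho -> A + (rho - 1) <= eta ->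
  (forall s s', 0 <= s < s' -> (forall K, exists k, (K <= k)%nat /\ V k <= s * mu k) -> hausdorff_null s' (U t1)) ->
  (forall s, 0 < s < 1 -> (exists K, forall k, (K <= k)%nat -> s * mu' k <= V' k) -> ~ hausdorff_null s (U t2)) ->
  (forall k, a k <= mu k) -> (forall k, V k - A * a k <= V' k) -> (forall k, mu' k <= rho * mu k) ->
  dim_drop_le eta t1 t2.
Proof.
  intros Heta HA Hrho Hsum Hup Hlow Hmu HV Hmu' d Hd s Hs Hsd.
  apply Hlow; [assumption|].
  assert (~ (forall K, exists k, (K <= k)%nat /\ V k <= (s + eta) * mu k)) as Hn.
  { intro Hf. apply (Hup _ (s + eta + eta / 2)) in Hf; [|lra]. apply Hd in Hf; lra. }
  apply not_all_ex_not in Hn. destruct Hn as [K HK]. exists K. intros k Hk.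
  assert ((s + eta) * mu k < V k) as HVk.
  { apply Rnot_le_lt. intro. apply HK. eauto. }
  specialize (Hmu k). specialize (HV k). specialize (Hmu' k). pose proof (lden_ge0 theta cf k).
  assert (s * mu' k <= s * (rho * mu k)) by (apply Rmult_le_compat_l; lra).
  assert (s * (rho * mu k) <= s * mu k + (rho - 1) * mu k).
  { assert (0 <= (1 - s) * ((rho - 1) * mu k)); [|lra]. apply Rmult_le_pos; [lra|]. apply Rmult_le_pos; lra. }
  assert (A * a k <= A * mu k) by (apply Rmult_le_compat_l; lra).
  assert ((A + (rho - 1)) * mu k <= eta * mu k) by (apply Rmult_le_compat_r; lra).
  lra.
Qed.

Lemma ratio_bounds t : 0 < t -> 0 < t / (1 + t) < 1 /\ t / (1 + t) * (1 + t) = t.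
Proof.
  intro Ht. split; [split; [apply Rdiv_lt_0_compat; lra|]|field; lra].
  apply Rmult_lt_reg_r with (1 + t); [lra|]. unfold Rdiv. rewrite Rmult_assoc, Rinv_l; lra.
Qed.

(** The upper bound at t1 is read at the left end of the window and the lower bound at t2 at the
    right end. This places no order on t1 and t2, so exchanging them yields both halves of
    continuity. *)
Lemma dim_drop_lo cl cu eta t1 t2 : 0 < t1 -> 0 < t2 -> 0 < cl ->
  cl < t1 / (1 + t1) < cu -> cl < t2 / (1 + t2) < cu -> cu < 1 / 2 ->
  (cu - cl) / (1 - 2 * cu) + (cu / cl - 1) <= eta -> dim_drop_le eta t1 t2.
Proof.
  intros H1 H2 Hcl Hc1 Hc2 Hcu Heta.
  destruct (ratio_bounds t1 H1) as [B1 E1]. destruct (ratio_bounds t2 H2) as [B2 E2].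
  set (c1 := t1 / (1 + t1)) in *. set (c2 := t2 / (1 + t2)) in *.
  assert (HA : 0 < (cu - cl) / (1 - 2 * cu)) by (apply Rdiv_lt_0_compat; lra).
  assert (Hr : 1 <= cu / cl).
  { apply Rmult_le_reg_r with cl; [lra|]. unfold Rdiv. rewrite Rmult_assoc, Rinv_l; lra. }
  apply (dim_drop_of_rates (V_lo theta cf cl) (V_lo theta cf cu) (mu_lo theta cf cl) (mu_lo theta cf cu)
    ((cu - cl) / (1 - 2 * cu)) (cu / cl)); try lra.
  - intros s s' Hs. apply (U_null_lo theta cf t1 c1 cl s s'); lra.
  (* The midpoint lies strictly above c2, for the slack in tau, and strictly below cu, for the slack
     in the constants. *)
  - intros s Hs. apply (U_not_null_lo theta cf t2 ((c2 + cu) / 2) cu s); try lra.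
    assert (t2 * (1 - c2) = c2) by lra. nra.
  - intro k. apply Rmax_l.
  - intro k. apply V_lo_continuous; lra.
  - intro k. apply mu_lo_continuous; lra.
Qed.

Lemma dim_drop_hi cl cu eta t1 t2 : 0 < theta < 1 -> 0 < t1 -> 0 < t2 -> 1 / 2 < cl ->
  cl < t1 / (1 + t1) < cu -> cl < t2 / (1 + t2) < cu -> cu < 1 ->
  (cu - cl) / (2 * cl - 1) + (cu * (1 - cl) / (cl * (1 - cu)) - 1) <= eta -> dim_drop_le eta t1 t2.
Proof.
  intros Hth H1 H2 Hcl Hc1 Hc2 Hcu Heta.
  destruct (ratio_bounds t1 H1) as [B1 E1]. destruct (ratio_bounds t2 H2) as [B2 E2].
  set (c1 := t1 / (1 + t1)) in *. set (c2 := t2 / (1 + t2)) in *.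
  assert (HA : 0 < (cu - cl) / (2 * cl - 1)) by (apply Rdiv_lt_0_compat; lra).
  assert (Hp : 0 < cl * (1 - cu)) by (apply Rmult_lt_0_compat; lra).
  assert (Hr : 1 <= cu * (1 - cl) / (cl * (1 - cu))).
  { apply Rmult_le_reg_r with (cl * (1 - cu)); [assumption|]. unfold Rdiv. rewrite Rmult_assoc, Rinv_l; lra. }
  apply (dim_drop_of_rates (V_hi theta cf cl) (V_hi theta cf cu) (mu_hi theta cf cl) (mu_hi theta cf cu)
    ((cu - cl) / (2 * cl - 1)) (cu * (1 - cl) / (cl * (1 - cu)))); try lra.
  - intros s s' Hs. apply (U_null_hi theta cf t1 c1 cl s s'); lra.
  - intros s Hs. apply (U_not_null_hi theta cf t2 c2 cu s); lra.
  - intro k. apply mu_hi_ge_lden. lra.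
  - intro k. apply V_hi_continuous; lra.
  - intro k. apply mu_hi_continuous; lra.
Qed.

Lemma ratio_close t tau h : 0 < t -> 0 < tau -> Rabs (t - tau) < h ->
  tau / (1 + tau) - h < t / (1 + t) < tau / (1 + tau) + h.
Proof.
  intros Ht Htau H. apply Rabs_def2 in H.
  assert (E : t / (1 + t) - tau / (1 + tau) = (t - tau) * / ((1 + t) * (1 + tau))) by (field; lra).
  assert (Hi : 0 < / ((1 + t) * (1 + tau)) <= 1).
  { assert (1 <= (1 + t) * (1 + tau)) by nra. split; [apply Rinv_0_lt_compat; lra|].
    rewrite <- Rinv_1. apply Rinv_le_contravar; lra. }
  nra.
Qed.

(** The window is c - h to c + h. Half of the bounds on h keep it on one side of 1/2 and inside (0,
    1); the others make the variation of V and that of mu at most eta / 2 each. *)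
Lemma dim_drop_near tau eta : 0 < theta < 1 -> 0 < tau -> tau <> 1 -> 0 < eta ->
  exists h, 0 < h /\ forall t1 t2, Rabs (t1 - tau) < h -> Rabs (t2 - tau) < h -> dim_drop_le eta t1 t2.
Proof.
  intros Hth Htau Hne Heta.
  destruct (ratio_bounds tau Htau) as [B E]. set (c := tau / (1 + tau)) in *.
  assert (Hpos : forall h, h <= tau -> forall t, Rabs (t - tau) < h -> 0 < t).
  { intros h Hh t H. apply Rabs_def2 in H. lra. }
  destruct (Rtotal_order tau 1) as [Hlt|[Heq|Hgt]]; [|contradiction|].
  - assert (Hc : c < 1 / 2) by nra.
    set (h := Rmin tau (Rmin (Rmin (c / 2) ((1 / 2 - c) / 2)) (Rmin (eta * (1 - 2 * c) / 8) (eta * c / 8)))).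
    assert (Hh : h <= tau /\ h <= c / 2 /\ h <= (1 / 2 - c) / 2 /\ h <= eta * (1 - 2 * c) / 8 /\ h <= eta * c / 8).
    { unfold h. repeat split.
      - apply Rmin_l.
      - eapply Rle_trans; [apply Rmin_r|]. eapply Rle_trans; [apply Rmin_l|apply Rmin_l].
      - eapply Rle_trans; [apply Rmin_r|]. eapply Rle_trans; [apply Rmin_l|apply Rmin_r].
      - eapply Rle_trans; [apply Rmin_r|]. eapply Rle_trans; [apply Rmin_r|apply Rmin_l].
      - eapply Rle_trans; [apply Rmin_r|]. eapply Rle_trans; [apply Rmin_r|apply Rmin_r]. }
    assert (Hh0 : 0 < h) by (unfold h; repeat apply Rmin_glb_lt; nra).
    destruct Hh as (Hh1 & Hh2 & Hh3 & Hh4 & Hh5).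
    exists h. split; [assumption|]. intros t1 t2 D1 D2.
    apply (dim_drop_lo (c - h) (c + h)); try lra; try (apply ratio_close; eauto); eauto.
    assert ((c + h - (c - h)) / (1 - 2 * (c + h)) <= eta / 2).
    { apply Rdiv_le_of_le_mul; [lra|].
      apply Rle_trans with (eta / 2 * ((1 - 2 * c) / 2)); [lra|]. apply Rmult_le_compat_l; lra. }
    assert ((c + h) / (c - h) <= 1 + eta / 2); [|lra].
    apply Rdiv_le_of_le_mul; [lra|].
    assert (eta / 2 * (c / 2) <= eta / 2 * (c - h)) by (apply Rmult_le_compat_l; lra). lra.
  - assert (Hc : 1 / 2 < c) by nra.
    set (h := Rmin tau (Rmin (Rmin ((c - 1 / 2) / 2) ((1 - c) / 2)) (Rmin (eta * (2 * c - 1) / 8) (eta * (1 - c) / 16)))).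
    assert (Hh : h <= tau /\ h <= (c - 1 / 2) / 2 /\ h <= (1 - c) / 2 /\ h <= eta * (2 * c - 1) / 8 /\ h <= eta * (1 - c) / 16).
    { unfold h. repeat split.
      - apply Rmin_l.
      - eapply Rle_trans; [apply Rmin_r|]. eapply Rle_trans; [apply Rmin_l|apply Rmin_l].
      - eapply Rle_trans; [apply Rmin_r|]. eapply Rle_trans; [apply Rmin_l|apply Rmin_r].
      - eapply Rle_trans; [apply Rmin_r|]. eapply Rle_trans; [apply Rmin_r|apply Rmin_l].
      - eapply Rle_trans; [apply Rmin_r|]. eapply Rle_trans; [apply Rmin_r|apply Rmin_r]. }
    assert (Hh0 : 0 < h) by (unfold h; repeat apply Rmin_glb_lt; nra).
    destruct Hh as (Hh1 & Hh2 & Hh3 & Hh4 & Hh5).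
    exists h. split; [assumption|]. intros t1 t2 D1 D2.
    apply (dim_drop_hi (c - h) (c + h)); try lra; try (apply ratio_close; eauto); eauto.
    assert ((c + h - (c - h)) / (2 * (c - h) - 1) <= eta / 2).
    { apply Rdiv_le_of_le_mul; [lra|].
      apply Rle_trans with (eta / 2 * ((2 * c - 1) / 2)); [lra|]. apply Rmult_le_compat_l; lra. }
    assert ((c + h) * (1 - (c - h)) / ((c - h) * (1 - (c + h))) <= 1 + eta / 2); [|lra].
    apply Rdiv_le_of_le_mul; [apply Rmult_lt_0_compat; lra|].
    assert ((1 - c) / 4 <= (c - h) * (1 - (c + h))).
    { replace ((1 - c) / 4) with (1 / 2 * ((1 - c) / 2)) by field. apply Rmult_le_compat; lra. }
    assert (eta / 2 * ((1 - c) / 4) <= eta / 2 * ((c - h) * (1 - (c + h)))) by (apply Rmult_le_compat_l; lra).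
    lra.
Qed.

End Continuity.

(** * Existence and range of the dimension, and the conclusion *)

Lemma in_torus_null s : 1 < s -> hausdorff_null s in_torus.
Proof.
  intro Hs. apply null_of_frequent_covers with (fun k => ln (INR (S k))) (fun k => ln (INR (S k))) 1 1; try lra.
  - intro B. destruct (exists_nat_between (exp B)) as (K & _ & HK & _); [left; apply exp_pos|].
    exists K. intros k Hk. rewrite <- (ln_exp B). apply ln_le; [apply exp_pos|].
    apply Rle_trans with (INR K); [lra|]. apply le_INR. lia.
  - intro K. exists K. split; [lia|lra].
  - exists 0%nat. intros k _. assert (0 < INR (S k)) by (apply lt_0_INR; lia).
    rewrite exp_Ropp, exp_ln by assumption.
    assert (0 < / INR (S k)) by (apply Rinv_0_lt_compat; assumption).
    apply covered_weaken with (1 * INR (S k)) (/ INR (S k)); [lra|lra|].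
    apply covered_split with 1; [rewrite Rinv_r; lra|assumption|lia|apply torus_covered].
Qed.

Lemma hausdorff_dim_exists (E : R -> Prop) : (forall x, E x -> in_torus x) -> {d | is_hausdorff_dim E d}.
Proof.
  intro HE.
  destruct (completeness (fun d => forall s, 0 <= s -> hausdorff_null s E -> d <= s)) as [d [Hd1 Hd2]].
  - exists 2. intros d Hd. apply Hd; [lra|]. apply null_subset with in_torus; [assumption|]. apply in_torus_null. lra.
  - exists 0. auto.
  - exists d. split.
    + intros s Hs Hn. apply Hd2. intros d' Hd'. auto.
    + intros d' Hd'. apply Hd1. assumption.
Qed.

Lemma hausdorff_dim_bounds E d : (forall x, E x -> in_torus x) -> is_hausdorff_dim E d -> 0 <= d <= 1.
Proof.
  intros HE [H1 H2]. split; [apply H2; auto|].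
  apply Rnot_lt_le. intro Hlt. specialize (H1 ((1 + d) / 2) ltac:(lra)).
  enough (d <= (1 + d) / 2) by lra. apply H1. apply null_subset with in_torus; [assumption|]. apply in_torus_null. lra.
Qed.

Lemma hausdorff_null_above_dim E d s : is_hausdorff_dim E d -> d < s -> hausdorff_null s E.
Proof.
  intros [_ H2] Hs. apply NNPP. intro Hn. specialize (H2 s).
  enough (s <= d) by lra. apply H2. intros s' Hs' Hnull. apply Rnot_lt_le. intro Hlt.
  apply Hn. apply null_larger_exponent with s'; [lra|assumption].
Qed.

Theorem theorem4 (theta : R) (Hirr : irrational theta) (H0 : 0 < theta) (H1 : theta < 1) :
  exists f : R -> R,
    (forall tau, 0 < tau -> tau <> 1 -> is_hausdorff_dim (U_set tau theta) (f tau)) /\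
    (forall tau, 0 < tau -> tau <> 1 -> continuity_pt f tau).
Proof.
  assert (HU : forall tau y, U_set tau theta y -> in_torus y) by (intros tau y [Hy _]; assumption).
  set (f := fun tau => proj1_sig (hausdorff_dim_exists _ (HU tau))).
  assert (Hf : forall tau, is_hausdorff_dim (U_set tau theta) (f tau)) by (intro tau; apply (proj2_sig (hausdorff_dim_exists _ (HU tau)))).
  (* If f t2 < f t1 - 2 eta, this last number lies in (0, 1) by the range of f and is an exponent
     above the dimension at t2, so the set there would be null at it. *)
  assert (Hdrop : forall eta t1 t2, 0 < eta -> dim_drop_le theta eta t1 t2 -> f t1 - 2 * eta <= f t2).
  { intros eta t1 t2 Heta Hd. apply Rnot_lt_le. intro Hlt.
    destruct (hausdorff_dim_bounds _ _ (HU t1) (Hf t1)). destruct (hausdorff_dim_bounds _ _ (HU t2) (Hf t2)).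
    apply (Hd (f t1) (proj1 (Hf t1)) (f t1 - 2 * eta)); [lra|lra|].
    apply (hausdorff_null_above_dim _ _ _ (Hf t2) Hlt). }
  exists f. split; [auto|].
  intros tau Htau Hne. destruct (convergents_exist theta Hirr H0 H1) as [cf].
  intros eps Heps.
  destruct (dim_drop_near theta cf tau (eps / 4)) as (h & Hh & Hnear); [lra|assumption|assumption|lra|].
  exists h. split; [assumption|]. intros t [_ Ht]. simpl in Ht |- *. unfold Rdist in Ht |- *.
  assert (Htt : Rabs (tau - tau) < h) by (rewrite Rminus_diag, Rabs_R0; assumption).
  pose proof (Hdrop (eps / 4) _ _ ltac:(lra) (Hnear t tau Ht Htt)).
  pose proof (Hdrop (eps / 4) _ _ ltac:(lra) (Hnear tau t Htt Ht)).
  apply Rle_lt_trans with (eps / 2); [|lra]. apply Rabs_le. lra.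
Qed.
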